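(* Let $T\subseteq\mathbb R$ be an interval with $0\in T$, and let $u:T\to\mathcal V_{[0,1]}$ and $\beta:T\to\mathcal V$. Then $(u,\beta)$ is a solution to double-obstacle Allen--Cahn (AC) flow on $T$ if and only if all of the following hold: $\beta$ is locally integrable and locally bounded a.e. (i.e. integrable and bounded a.e. on every bounded subset of $T$); $\beta(t)\in\mathcal B(u(t))$ for a.e. $t\in T$; and for all $t\in T$ $$u(t)=\tfrac12\mathbf 1+e^{t/\varepsilon}e^{-t\Delta}\left(u(0)-\tfrac12\mathbf 1\right)+\frac1\varepsilon\int_0^t e^{(t-s)/\varepsilon}e^{-(t-s)\Delta}\beta(s)\,ds .$$
   Context: Let $G=(V,E)$ be a finite, undirected, simple, connected graph with symmetric weights $\omega_{ij}=\omega_{ji}$, $\omega_{ij}>0$ for $ij\in E$ and $\omega_{ij}=0$ for $ij\notin E$. Let $d_i=\sum_{j}\omega_{ij}>0$ be the degree of $i\in V$. Fix $r\in[0,1]$ and $\varepsilon>0$. Let $\mathcal V=\{u:V\to\mathbb R\}$ and, for $X\subseteq\mathbb R$, $\mathcal V_X=\{u:V\to X\}$; $\mathcal V$ carries the inner product $\langle u,v\rangle_{\mathcal V}=\sum_{i\in V}u_iv_id_i^r$ with norm $\|\cdot\|_{\mathcal V}$. $\mathbf 1\in\mathcal V$ is the constant function $1$. The graph Laplacian is $(\Delta u)_i=d_i^{-r}\sum_{j\in V}\omega_{ij}(u_i-u_j)$, and $e^{-t\Delta}=\sum_{n\ge0}\frac{(-1)^nt^n}{n!}\Delta^n$. For an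 open interval $T$, $H^1(T;\mathcal V)$ is the set of $u\in L^2(T;\mathcal V)$ with generalised (weak) time derivative $du/dt\in L^2(T;\mathcal V)$. For any interval $T$, $H^1_{loc}(T;\mathcal V)$ is the set of $u:T\to\mathcal V$ with $u\in H^1((a,b);\mathcal V)$ for all $a,b\in T$ with $a<b$. For $u\in\mathcal V_{[0,1]}$, $\mathcal B(u)$ is the set of $\alpha\in\mathcal V$ such that for each $i\in V$: $\alpha_i\ge0$ if $u_i=0$, $\alpha_i=0$ if $0<u_i<1$, and $\alpha_i\le0$ if $u_i=1$. A pair $(u,\beta)$ with $u:T\to\mathcal V_{[0,1]}$, $\beta:T\to\mathcal V$ is a solution to double-obstacle AC flow on an interval $T$ if $u\in H^1_{loc}(T;\mathcal V)\cap C^0(T;\mathcal V)$ and for a.e. $t\in T$, $\varepsilon\frac{du}{dt}+\varepsilon\Delta u(t)+\frac12\mathbf 1-u(t)=\beta(t)$ and $\beta(t)\in\mathcal B(u(t))$. *)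

(* Defs.v *)
From HB Require Import structures.
From mathcomp Require Import all_boot all_order all_algebra.
From mathcomp Require Import all_classical all_reals all_analysis.

Set Implicit Arguments.
Unset Strict Implicit.
Unset Printing Implicit Defensive.

Import Order.TTheory GRing.Theory Num.Theory.
Import numFieldNormedType.Exports.

Local Open Scope classical_set_scope.
Local Open Scope ring_scope.

(** * Weighted graphs *)

Record wgraph (R : realType) (V : finType) := WGraph {
  edge : rel V;
  edge_sym : symmetric edge;
  edge_irr : irreflexive edge;
  edge_connected : forall i j, connect edge i j;
  weight : V -> V -> R;
  weight_sym : forall i j, weight i j = weight j i;
  weight_gt0 : forall i j, edge i j -> 0 < weight i j;
  weight_eq0 : forall i j, ~~ edge i j -> weight i j = 0;
  (* only excludes the graph with a single vertex *)
  degree_gt0 : forall i, 0 < \sum_j weight i j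
}.

Definition degree (R : realType) (V : finType) (G : wgraph R V) (i : V) : R :=
  \sum_j weight G i j.

Definition innerV (R : realType) (V : finType) (G : wgraph R V) (r : R)
    (u v : V -> R) : R :=
  \sum_i u i * v i * degree G i `^ r.

Definition normV (R : realType) (V : finType) (G : wgraph R V) (r : R)
    (u : V -> R) : R :=
  Num.sqrt (innerV G r u u).

Definition laplacian (R : realType) (V : finType) (G : wgraph R V) (r : R)
    (u : V -> R) : V -> R :=
  fun i => degree G i `^ (- r) * \sum_j weight G i j * (u i - u j).

(** [heat G r t] is [exp (- t Delta)]: the exponential series applied to [u]. *)
Definition heat (R : realType) (V : finType) (G : wgraph R V) (r t : R)
    (u : V -> R) : V -> R :=
  fun i => limn (series (fun n : nat =>
    (-1) ^+ n * t ^+ n / n`!%:R * iter n (laplacian G r) u i)).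

(** * Lebesgue integration of functions with values in [V -> R]

    [lebesgue_measure] only measures Borel sets, but here functions matter up to
    null sets only: [lebesgueR R] is [R] with the sigma-algebra of all
    Lebesgue-measurable sets, the domain of [completed_lebesgue_measure].
    As [V -> R] is finite-dimensional, measurability and (Bochner)
    integrability and integrals are componentwise. *)

Notation lebesgueR R := (caratheodory_type ((@wlength R idfun)^*)%mu).

Definition measurableV (R : realType) (V : finType) (A : set R)
    (f : R -> V -> R) : Prop :=
  forall i, @measurable_fun _ _ (lebesgueR R) R A (fun t => f t i).

Definition integrableV (R : realType) (V : finType) (A : set R)
    (f : R -> V -> R) : Prop :=
  forall i, (@completed_lebesgue_measure R).-integrable A
    (fun t => (f t i)%:E).

Definition integralV (R : realType) (V : finType) (A : set R)
    (f : R -> V -> R) : V -> R :=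
  fun i => \int[@completed_lebesgue_measure R]_(t in A) f t i.

(** The oriented integral from [a] to [b], for any order of [a] and [b]. *)
Definition ointegralV (R : realType) (V : finType) (a b : R)
    (f : R -> V -> R) : V -> R :=
  if a <= b then integralV `[a, b] f else - integralV `[b, a] f.

(** * Sobolev spaces in time

    Functions on a subset [T] of [R] are total functions of which only the
    values on [T] are used. *)

Definition L2 (R : realType) (V : finType) (G : wgraph R V) (r : R)
    (T : set R) (u : R -> V -> R) : Prop :=
  measurableV T u /\
  (\int[@completed_lebesgue_measure R]_(t in T)
     (normV G r (u t) ^+ 2)%:E < +oo)%E.

(** Smooth functions with compact support in the open set [T]. *)
Definition test_function (R : realType) (T : set R) (phi : R -> R) : Prop :=
  [/\ forall (n : nat) (x : R), derivable (derive1n n phi) x 1,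
      compact (closure [set x | phi x != 0]) &
      closure [set x | phi x != 0] `<=` T].

Definition weak_derivative (R : realType) (V : finType) (T : set R)
    (u du : R -> V -> R) : Prop :=
  forall phi : R -> R, test_function T phi ->
    integralV T (fun t => derive1 phi t *: u t) =
    - integralV T (fun t => phi t *: du t).

Definition H1 (R : realType) (V : finType) (G : wgraph R V) (r : R)
    (T : set R) (u : R -> V -> R) : Prop :=
  L2 G r T u /\ exists du, L2 G r T du /\ weak_derivative T u du.

Definition H1loc (R : realType) (V : finType) (G : wgraph R V) (r : R)
    (T : set R) (u : R -> V -> R) : Prop :=
  forall a b : R, T a -> T b -> a < b -> H1 G r `]a, b[ u.

(** [du] represents the time derivative on [T] of the [H1loc] function [u];
    it is determined almost everywhere on [T]. *)
Definition time_derivative (R : realType) (V : finType) (G : wgraph R V)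
    (r : R) (T : set R) (u du : R -> V -> R) : Prop :=
  forall a b : R, T a -> T b -> a < b ->
    L2 G r `]a, b[ du /\ weak_derivative `]a, b[ u du.

Definition continuousV (R : realType) (V : finType) (G : wgraph R V) (r : R)
    (T : set R) (u : R -> V -> R) : Prop :=
  forall t, T t -> normV G r (u s - u t) @[s --> within T (nbhs t)] --> 0.

(** * Double-obstacle Allen-Cahn flow *)

Definition V01 (R : realType) (V : finType) (u : V -> R) : Prop :=
  forall i, 0 <= u i <= 1.

Definition Bset (R : realType) (V : finType) (u : V -> R) : set (V -> R) :=
  [set alpha | forall i, [/\ u i = 0 -> 0 <= alpha i,
                             0 < u i < 1 -> alpha i = 0 &
                             u i = 1 -> alpha i <= 0]].

Definition AC_solution (R : realType) (V : finType) (G : wgraph R V)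
    (r eps : R) (T : set R) (u beta : R -> V -> R) : Prop :=
  [/\ forall t, T t -> V01 (u t),
      H1loc G r T u,
      continuousV G r T u &
      exists2 du, time_derivative G r T u du &
        {ae @completed_lebesgue_measure R, forall t, T t ->
          eps *: du t + eps *: laplacian G r (u t) + cst 2^-1 - u t = beta t
          /\ Bset (u t) (beta t)}].

(** Integrability only makes sense on the measurable bounded subsets. *)
Definition locally_integrableV (R : realType) (V : finType) (T : set R)
    (f : R -> V -> R) : Prop :=
  forall A : set R, A `<=` T -> bounded_set A ->
    @measurable _ (lebesgueR R) A -> integrableV A f.

Definition locally_ae_bounded (R : realType) (V : finType) (G : wgraph R V)
    (r : R) (T : set R) (f : R -> V -> R) : Prop :=
  forall A : set R, A `<=` T -> bounded_set A ->
    exists M : R, {ae @completed_lebesgue_measure R, forall t, A t ->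
      normV G r (f t) <= M}.

(* Main.v *)
Require Import Defs.
From HB Require Import structures.
From mathcomp Require Import all_boot all_order all_algebra.
From mathcomp Require Import all_classical all_reals all_analysis.
From mathcomp Require Import measurable_realfun ring lra.

(** Put [w = u - 1/2] and [M = 1/eps - Delta]. As [Delta] annihilates constants,
    the flow equation reads [w' = M w + beta / eps], and the integral formula is
    its variation of constants formula, because
    [exp (t M) = e^(t/eps) e^(-t Delta)].

    For essentially bounded [beta] the equivalence between this linear equation
    and its variation of constants formula ([duhamel], [duhamel_conv]) only needs
    the Leibniz rule for Lipschitz functions given as integrals of bounded
    functions ([primitive]). That rule ([primitiveM]) is elementary: the defect
    over an interval is quadratic in its length, so it vanishes after refining the
    interval. The same rule, applied to a product with a test function, shows that
    a function given by the formula has a weak derivative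
    ([primitive_weak_derivative]).

    A solution must therefore be shown to have a bounded [beta] and to be the
    integral of its weak derivative. The latter is the fundamental lemma of the
    calculus of variations in the form [weak_derivative_increment]; it uses smooth
    test functions approximating the indicator of an interval, built from
    [exp (-1/x)]. Boundedness is the one place where the obstacles matter: [u i] is
    differentiable almost everywhere, and where it equals [0] or [1] it has an
    extremum, so its derivative vanishes there
    ([derivative_zero_at_minimum]). On that set the equation gives
    [beta i = eps (Delta u) i + 1/2 - u i], which is bounded; elsewhere
    [beta i = 0] ([AC_beta_bound]). *)

Set Implicit Arguments.
Unset Strict Implicit.
Unset Printing Implicit Defensive.

Import Order.TTheory GRing.Theory Num.Theory.
Import numFieldNormedType.Exports.

Local Open Scope classical_set_scope.
Local Open Scope ring_scope.

Local Notation mu R := (@completed_lebesgue_measure R).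
Local Notation borelR R := (measurableTypeR R).

(** * Integration over the completed Lebesgue measure *)

Lemma borel_lebesgue (R : realType) (A : set R) :
  @measurable _ (borelR R) A -> @measurable _ (lebesgueR R) A.
Proof. exact: sub_caratheodory. Qed.

Lemma measurable_itvL (R : realType) (i : interval R) :
  @measurable _ (lebesgueR R) [set` i].
Proof. by apply: borel_lebesgue; exact: measurable_itv. Qed.

Lemma borel_lebesgue_fun (R : realType) (D : set R) (f : R -> R) :
  @measurable _ (borelR R) D ->
  @measurable_fun _ _ (borelR R) R D f ->
  @measurable_fun _ _ (lebesgueR R) R D f.
Proof. by move=> mD mf _ B mB; apply: borel_lebesgue; exact: mf. Qed.

Lemma continuous_lebesgue_fun (R : realType) (D : set R) (f : R -> R) :
  @measurable _ (borelR R) D -> {within D, continuous f} ->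
  @measurable_fun _ _ (lebesgueR R) R D f.
Proof.
move=> mD cf; apply: borel_lebesgue_fun => //.
exact: subspace_continuous_measurable_fun.
Qed.

(** Both measures restrict the same outer measure, so the Borel one is the image
    of the completed one under the identity. This makes results about the Borel
    measure (fundamental theorem of calculus, Lebesgue differentiation)
    applicable to integrals over the completed measure. *)
Lemma integral_lebesgue_borel (R : realType) (D : set R) (f : R -> R) :
  @measurable _ (borelR R) D -> @measurable_fun _ _ (borelR R) R D f ->
  (mu R).-integrable D (EFin \o f) ->
  (@lebesgue_measure R).-integrable D (EFin \o f) /\
  \int[mu R]_(x in D) f x =
  \int[@lebesgue_measure R]_(x in D) f x.
Proof.
move=> mD mf intf.
have mid : @measurable_fun _ _ (lebesgueR R) (borelR R) setT idfun.
  by move=> _ B mB; rewrite setTI; exact: borel_lebesgue.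
have mfD : @measurable_fun _ _ (borelR R) (\bar R) setT ((EFin \o f) \_ D).
  apply/(measurable_restrictT _ mD); exact/measurable_EFinP.
have intfD : (mu R).-integrable setT ((EFin \o f) \_ D).
  exact/(integrable_mkcond _ (borel_lebesgue mD)).
have intB : (@lebesgue_measure R).-integrable setT ((EFin \o f) \_ D).
  exact: (@integrable_pushforward _ _ (lebesgueR R) (borelR R) R idfun
    mid _ setT _ mfD intfD measurableT).
split; first by apply/integrable_mkcond.
rewrite /Rintegral integral_mkcond [in RHS]integral_mkcond; congr fine.
exact/esym/(@integral_pushforward _ _ (lebesgueR R) (borelR R) R idfun
  mid _ setT _ mfD intfD measurableT).
Qed.

Lemma mu_itvcc (R : realType) (a b : R) : a <= b ->
  mu R `[a, b] = (b - a)%:E.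
Proof.
move=> ab; have := @lebesgue_measure_itv R `[a, b].
rewrite /= lte_fin => E; transitivity (@lebesgue_measure R `[a, b]) => //.
rewrite E; case: ltP => // ba; congr EFin.
by apply/esym/eqP; rewrite subr_eq0 eq_le ab ba.
Qed.

Lemma mu_bounded_lty (R : realType) (a b : R) (A : set R) :
  @measurable _ (lebesgueR R) A -> A `<=` `[a, b] ->
  (mu R A < +oo)%E.
Proof.
move=> mA Aab; have [ab|ba] := leP a b; last first.
  rewrite (_ : A = set0) ?measure0 ?ltry//.
  by apply/seteqP; split => // x /Aab; rewrite set_itv_ge// bnd_simp -ltNge.
apply: (@le_lt_trans _ _ (mu R `[a, b])).
  by apply: le_measure => //; rewrite inE//; exact: measurable_itvL.
by rewrite (_ : completed_lebesgue_measure _ = (b - a)%:E) ?ltry//; exact: mu_itvcc.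
Qed.

Lemma mu_set1 (R : realType) (a : R) :
  mu R [set a] = 0%E.
Proof. exact: (@lebesgue_measure_set1 R a). Qed.

Lemma ae_mu_filter (R : realType) :
  Filter (almost_everywhere (mu R)).
Proof. exact: ae_filter_ringOfSetsType. Qed.

Lemma ae_imply (R : realType) (P Q : R -> Prop) :
  {ae mu R, forall t, P t} ->
  (forall t, P t -> Q t) ->
  {ae mu R, forall t, Q t}.
Proof. by move=> hP PQ; have F := ae_mu_filter R; exact: filterS hP. Qed.

Lemma ae_imply2 (R : realType) (P1 P2 Q : R -> Prop) :
  {ae mu R, forall t, P1 t} ->
  {ae mu R, forall t, P2 t} ->
  (forall t, P1 t -> P2 t -> Q t) ->
  {ae mu R, forall t, Q t}.
Proof. by move=> h1 h2 PQ; have F := ae_mu_filter R; exact: filterS2 h1 h2. Qed.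

Lemma ae_all (R : realType) (I : finType) (P : I -> R -> Prop) :
  (forall i, {ae mu R, forall t, P i t}) ->
  {ae mu R, forall t, forall i, P i t}.
Proof.
move=> h; have F := ae_mu_filter R.
by apply: filter_forall => i; exact: h.
Qed.

Lemma ae_eq_measurable (R : realType) (D : set R) (f g : R -> R) :
  {ae mu R, forall t, D t -> f t = g t} ->
  @measurable_fun _ _ (lebesgueR R) R D f ->
  @measurable_fun _ _ (lebesgueR R) R D g.
Proof.
move=> fg /measurable_EFinP mf; apply/measurable_EFinP.
apply: (@ae_measurable_fun _ _ _ (mu R)
    (@completed_lebesgue_measure_is_complete R) _ (EFin \o f)) => //.
by apply: (ae_imply fg) => t h Dt /=; rewrite h.
Qed.

Lemma ae_eq_Rintegral (R : realType) (D : set R) (f g : R -> R) :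
  @measurable _ (lebesgueR R) D ->
  {ae mu R, forall t, D t -> f t = g t} ->
  @measurable_fun _ _ (lebesgueR R) R D f ->
  \int[mu R]_(t in D) f t =
  \int[mu R]_(t in D) g t.
Proof.
move=> mD fg mf; congr fine; apply: ae_eq_integral; first exact: mD.
- exact/measurable_EFinP.
- by apply/measurable_EFinP; exact: ae_eq_measurable mf.
- by apply: (ae_imply fg) => t h Dt /=; rewrite h.
Qed.

Lemma Rintegral_point (R : realType) (a : R) (g : R -> R) :
  \int[mu R]_(t in `[a, a]) g t = 0.
Proof.
have m1 : @measurable _ (lebesgueR R) [set a] by rewrite -set_itv1; exact: measurable_itvL.
have mg : @measurable_fun _ _ (lebesgueR R) (\bar R) [set a] (EFin \o g).
  exact: measurable_fun_set1.
rewrite set_itv1; exact: (congr1 fine (null_set_integral m1 mg (mu_set1 a))).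
Qed.

Lemma Rintegral_cat (R : realType) (a b c : R) (g : R -> R) :
  a <= b -> b <= c ->
  (mu R).-integrable `[a, c] (EFin \o g) ->
  \int[mu R]_(t in `[a, c]) g t =
  \int[mu R]_(t in `[a, b]) g t +
  \int[mu R]_(t in `[b, c]) g t.
Proof.
move=> ab bc ig.
have mi := @measurable_itvL R.
have sub1 : `[a, b]%classic `<=` `[a, c]%classic.
  by apply: subset_itvl; rewrite bnd_simp.
have sub2 : `[b, c]%classic `<=` `[a, c]%classic.
  by apply: subset_itvr; rewrite bnd_simp.
have E : `[a, c]%classic = `[a, b]%classic `|` (`[b, c]%classic `\` [set b]).
  apply/seteqP; split => x /=; rewrite !in_itv/=.
    move=> /andP[ax xc]; case: (leP x b) => xb; first by left; rewrite ax.
    by right; rewrite (ltW xb) xc; split => // xE; rewrite xE ltxx in xb.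
  by case=> [/andP[-> /le_trans->//]|[/andP[/(le_trans ab)-> ->]]].
rewrite {1}E Rintegral_setU//.
- congr (_ + fine _); apply/esym/negligible_integral => //.
  + by rewrite -set_itv1; exact: mi.
  + by apply: integrableS ig => //; exact: mi.
  + exact: mu_set1.
- by apply: measurableD => //; rewrite -set_itv1; exact: mi.
- by rewrite -E.
- apply/eqP/seteqP; split => // x /=; rewrite !in_itv/=.
  move=> [/andP[ax xb]] [/andP[bx xc]]; apply.
  by apply/eqP; rewrite eq_le xb bx.
Qed.

Lemma Rintegral_oo_cc (R : realType) (a b : R) (g : R -> R) :
  (mu R).-integrable `[a, b] (EFin \o g) ->
  \int[mu R]_(t in `]a, b[) g t =
  \int[mu R]_(t in `[a, b]) g t.
Proof.
move=> ig; have mi := @measurable_itvL R.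
have m1 c : @measurable _ (lebesgueR R) [set c] by rewrite -set_itv1; exact: mi.
have m2 : @measurable _ (lebesgueR R) [set a; b] by apply: measurableU.
have E : `]a, b[%classic = `[a, b]%classic `\` [set a; b].
  apply/seteqP; split => x /=; rewrite !in_itv/=.
    move=> /andP[ax xb]; rewrite !ltW//; split => // -[] xE.
      by rewrite xE ltxx in ax.
    by rewrite xE ltxx in xb.
  move=> [/andP[ax xb] /not_orP[/eqP xa /eqP xb']].
  by rewrite !lt_neqAle ax xb xb' eq_sym xa.
rewrite {1}E; congr fine; apply/esym/negligible_integral => //.
apply/eqP; rewrite eq_le measure_ge0 andbT.
apply: (le_trans (measureU2 _ _ _)) => //.
by rewrite -[leRHS]adde0; apply: leeD; rewrite le_eqVlt (introT eqP (mu_set1 _)).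
Qed.

(** * Essentially bounded functions *)

(** The bound is only almost everywhere because the forcing term [beta] of the
    flow is determined up to null sets. *)
Definition Linfty (R : realType) (D : set R) (g : R -> R) : Prop :=
  @measurable_fun _ _ (lebesgueR R) R D g /\
  exists M, {ae mu R, forall t, D t -> `|g t| <= M}.

Lemma LinftyD (R : realType) (D : set R) (f g : R -> R) :
  Linfty D f -> Linfty D g -> Linfty D (fun t => f t + g t).
Proof.
move=> [mf [M hM]] [mg [N hN]]; split; first exact: measurable_funD.
exists (M + N); apply: (ae_imply2 hM hN) => t h1 h2 Dt.
by rewrite (le_trans (ler_normD _ _))// lerD ?h1 ?h2.
Qed.

Lemma LinftyM (R : realType) (D : set R) (f g : R -> R) :
  Linfty D f -> Linfty D g -> Linfty D (fun t => f t * g t).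
Proof.
move=> [mf [M hM]] [mg [N hN]]; split; first exact: measurable_funM.
exists (M * N); apply: (ae_imply2 hM hN) => t h1 h2 Dt.
by rewrite normrM ler_pM ?h1 ?h2.
Qed.

Lemma Linfty_cst (R : realType) (D : set R) (c : R) : Linfty D (fun=> c).
Proof.
split; first exact: measurable_cst.
by exists `|c|; apply: aeW.
Qed.

Lemma LinftyZ (R : realType) (D : set R) (c : R) (f : R -> R) :
  Linfty D f -> Linfty D (fun t => c * f t).
Proof. by apply: LinftyM; exact: Linfty_cst. Qed.

Lemma Linfty_sum (R : realType) (D : set R) (I : Type) (s : seq I)
    (f : I -> R -> R) : (forall i, Linfty D (f i)) ->
  Linfty D (fun t => \sum_(i <- s) f i t).
Proof.
move=> hf; elim: s => [|i s ih].
  by under eq_fun do rewrite big_nil; exact: Linfty_cst.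
by under eq_fun do rewrite big_cons; exact: LinftyD.
Qed.

Lemma Linfty_sub (R : realType) (D E : set R) (f : R -> R) :
  @measurable _ (lebesgueR R) E ->
  D `<=` E -> Linfty E f -> Linfty D f.
Proof.
move=> mE DE [mf [M hM]]; split; first exact: measurable_funS mf.
by exists M; apply: (ae_imply hM) => t h /DE.
Qed.

Lemma continuous_Linfty (R : realType) (a b : R) (f : R -> R) :
  {within `[a, b], continuous f} -> Linfty `[a, b] f.
Proof.
move=> cf; split; first by apply: continuous_lebesgue_fun => //; exact: measurable_itv.
have [M [_ hM]] := compact_bounded (continuous_compact cf (@segment_compact R a b)).
exists (M + 1); apply: aeW => t /= abt.
by apply: hM; [rewrite ltrDl|exists t].
Qed.

Lemma Linfty_integral_le (R : realType) (D : set R) (M : R) (g : R -> R) :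
  @measurable _ (lebesgueR R) D ->
  @measurable_fun _ _ (lebesgueR R) R D g ->
  {ae mu R, forall t, D t -> `|g t| <= M} ->
  (\int[mu R]_(t in D) `|(g t)%:E| <=
    `|M|%:E * mu R D)%E.
Proof.
move=> mD mg hM; rewrite -integral_cst//.
have mag : @measurable_fun _ _ (lebesgueR R) (\bar R) D (fun t => `|(g t)%:E|)%E.
  have mEg : @measurable_fun _ _ (lebesgueR R) (\bar R) D (EFin \o g).
    exact/measurable_EFinP.
  exact: (measurableT_comp (@abse_measurable R setT) mEg).
apply: ae_ge0_le_integral => //; first by move=> t _ /=; rewrite lee_fin.
apply: (@ae_imply _ _ (fun t => D t -> (`|(g t)%:E| <= `|M|%:E)%E) hM) => t h /h.
by rewrite abse_EFin lee_fin => /le_trans; apply; exact: ler_norm.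
Qed.

Lemma Linfty_integrable_fin (R : realType) (D : set R) (g : R -> R) :
  @measurable _ (lebesgueR R) D -> (mu R D < +oo)%E ->
  Linfty D g -> (mu R).-integrable D (EFin \o g).
Proof.
move=> mD Doo [mg [M hM]]; apply/integrableP; split; first exact/measurable_EFinP.
apply: le_lt_trans (Linfty_integral_le mD mg hM) _.
by rewrite lte_mul_pinfty// lee_fin.
Qed.

Lemma Linfty_integrable (R : realType) (a b : R) (g : R -> R) :
  Linfty `[a, b] g ->
  (mu R).-integrable `[a, b] (EFin \o g).
Proof.
apply: Linfty_integrable_fin; first exact: measurable_itvL.
by apply: (@mu_bounded_lty _ a b) => //; exact: measurable_itvL.
Qed.

Lemma norm_Rintegral_le (R : realType) (a b M : R) (g : R -> R) :
  a <= b -> @measurable_fun _ _ (lebesgueR R) R `[a, b] g ->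
  {ae mu R, forall t, `[a, b]%classic t -> `|g t| <= M} ->
  `|\int[mu R]_(t in `[a, b]) g t| <= `|M| * (b - a).
Proof.
move=> ab mg hM; have mi := @measurable_itvL R `[a, b].
have le1 := Linfty_integral_le mi mg hM.
rewrite (_ : completed_lebesgue_measure _ = (b - a)%:E) in le1; last exact: mu_itvcc.
have ig : (mu R).-integrable `[a, b] (EFin \o g).
  by apply: Linfty_integrable; split=> //; exists M.
apply: le_trans (le_normr_Rintegral mi ig) _.
rewrite -lee_fin /Rintegral fineK//.
by rewrite ge0_fin_numE ?integral_ge0//; apply: le_lt_trans le1 _; rewrite ltry.
Qed.

(** * Primitives of essentially bounded functions *)

(** [f] is Lipschitz with almost everywhere derivative [g] on [[a, b]]. Stating
    this through increments keeps the calculus below free of differentiability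
    almost everywhere. *)
Definition primitive (R : realType) (a b : R) (f g : R -> R) : Prop :=
  Linfty `[a, b] g /\
  forall s t, a <= s -> s <= t -> t <= b ->
    f t - f s = \int[mu R]_(x in `[s, t]) g x.

Lemma sub_itvcc (R : realType) (a b s t : R) : a <= s -> t <= b ->
  `[s, t]%classic `<=` `[a, b]%classic.
Proof. by move=> a_s tb; apply: subset_itv; rewrite bnd_simp. Qed.

Lemma Linfty_subitv (R : realType) (a b s t : R) (g : R -> R) :
  a <= s -> t <= b -> Linfty `[a, b] g -> Linfty `[s, t] g.
Proof.
move=> a_s tb; apply: Linfty_sub; first exact: measurable_itvL.
exact: sub_itvcc.
Qed.

Lemma Linfty_integrable_sub (R : realType) (a b s t : R) (g : R -> R) :
  a <= s -> t <= b -> Linfty `[a, b] g ->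
  (mu R).-integrable `[s, t] (EFin \o g).
Proof. by move=> a_s tb /(Linfty_subitv a_s tb)/Linfty_integrable. Qed.

Lemma primitive_lip_bound (R : realType) (a b M : R) (f g : R -> R) :
  primitive a b f g ->
  {ae mu R, forall t, `[a, b]%classic t -> `|g t| <= M} ->
  forall s t, a <= s <= b -> a <= t <= b -> `|f t - f s| <= `|M| * `|t - s|.
Proof.
move=> [Lg fg] hM s t; wlog st : s t / s <= t.
  move=> H hs ht; case: (leP s t) => [/H|/ltW/H]; first exact.
  by rewrite distrC (distrC t); exact.
move=> /andP[a_s sb] /andP[at_ tb].
rewrite fg// (ger0_norm (_ : 0 <= t - s)) ?subr_ge0//.
have [+ _] := Linfty_subitv a_s tb Lg => mg.
apply: (norm_Rintegral_le st mg _); apply: (ae_imply hM) => x h /(sub_itvcc a_s tb).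
exact: h.
Qed.

Lemma primitive_lip (R : realType) (a b : R) (f g : R -> R) :
  primitive a b f g -> exists2 M, 0 <= M & 
  forall s t, a <= s <= b -> a <= t <= b -> `|f t - f s| <= M * `|t - s|.
Proof.
move=> fg; have [[mg [M hM]] _] := fg.
by exists `|M| => //; exact: primitive_lip_bound fg hM.
Qed.

Lemma primitive_continuous (R : realType) (a b : R) (f g : R -> R) :
  primitive a b f g -> {within `[a, b], continuous f}.
Proof.
move=> /primitive_lip[M M0 fM]; apply/subspace_continuousP => x /= abx.
apply/cvgrPdist_lt => e e0; near=> y.
have : `|f x - f y| <= M * `|x - y|.
  by apply: fM; [near: y; exact: withinT|move: abx; rewrite in_itv].
move=> /le_lt_trans; apply.
apply: (@le_lt_trans _ _ ((M + 1) * `|x - y|)).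
  by rewrite ler_wpM2r// lerDl.
rewrite -ltr_pdivlMl; last by rewrite ltr_wpDl.
near: y; apply: cvg_within; apply/nbhs_ballP.
by exists ((M + 1)^-1 * e) => //=; rewrite mulr_gt0// invr_gt0 ltr_wpDl.
Unshelve. all: by end_near. Qed.

Lemma primitive_Linfty (R : realType) (a b : R) (f g : R -> R) :
  primitive a b f g -> Linfty `[a, b] f.
Proof. by move=> /primitive_continuous; exact: continuous_Linfty. Qed.

Lemma primitive_sub (R : realType) (a b c d : R) (f g : R -> R) :
  a <= c -> d <= b -> primitive a b f g -> primitive c d f g.
Proof.
move=> ac db [Lg fg]; split; first exact: Linfty_subitv Lg.
by move=> s t cs st td; apply: fg => //; [exact: le_trans cs|exact: le_trans db].
Qed.

Lemma eq_primitive (R : realType) (a b : R) (f1 f2 g1 g2 : R -> R) :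
  (forall t, a <= t <= b -> f1 t = f2 t) ->
  (forall t, a <= t <= b -> g1 t = g2 t) ->
  primitive a b f1 g1 -> primitive a b f2 g2.
Proof.
move=> f12 g12 [[mg [M hM]] fg]; split.
  split.
    by apply: eq_measurable_fun mg => x; rewrite inE/= in_itv/= => /g12.
  exists M; apply: (ae_imply hM) => t + abt; move=> /(_ abt).
  by rewrite g12//; move: abt; rewrite /= in_itv.
move=> s t a_s st tb; rewrite -!f12 ?a_s ?tb ?(le_trans a_s)// ?(le_trans st)//.
rewrite fg//; apply: eq_Rintegral => x; rewrite inE/= in_itv/= => /andP[sx xt].
by rewrite g12// (le_trans a_s)// (le_trans xt).
Qed.

Lemma primitiveD (R : realType) (a b : R) (f1 f2 g1 g2 : R -> R) :
  primitive a b f1 g1 -> primitive a b f2 g2 ->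
  primitive a b (fun t => f1 t + f2 t) (fun t => g1 t + g2 t).
Proof.
move=> [L1 P1] [L2 P2]; split; first exact: LinftyD.
move=> s t a_s st tb; rewrite RintegralD//; last 2 first.
- exact: Linfty_integrable_sub L1.
- exact: Linfty_integrable_sub L2.
- by rewrite -P1// -P2//; ring.
- exact: measurable_itvL.
Qed.

Lemma primitiveZ (R : realType) (a b c : R) (f g : R -> R) :
  primitive a b f g -> primitive a b (fun t => c * f t) (fun t => c * g t).
Proof.
move=> [L1 P1]; split; first exact: LinftyZ.
move=> s t a_s st tb; rewrite RintegralZl//; first by rewrite -P1//; ring.
- exact: measurable_itvL.
- exact: Linfty_integrable_sub L1.
Qed.

Lemma primitive_cst (R : realType) (a b c : R) :
  primitive a b (fun=> c) (fun=> 0).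
Proof.
split; first exact: Linfty_cst.
by move=> s t _ _ _; rewrite subrr Rintegral_cst ?mul0r//; exact: measurable_itvL.
Qed.

Lemma primitive_sum (R : realType) (a b : R) (I : Type) (s : seq I)
    (f g : I -> R -> R) : (forall i, primitive a b (f i) (g i)) ->
  primitive a b (fun t => \sum_(i <- s) f i t) (fun t => \sum_(i <- s) g i t).
Proof.
move=> fg; elim: s => [|i s ih].
  under eq_fun do rewrite big_nil; under [X in primitive _ _ _ X]eq_fun do rewrite big_nil.
  exact: primitive_cst.
under eq_fun do rewrite big_cons; under [X in primitive _ _ _ X]eq_fun do rewrite big_cons.
exact: primitiveD.
Qed.

Lemma primitive_integral (R : realType) (a b : R) (g : R -> R) :
  Linfty `[a, b] g ->
  primitive a b
    (fun t => \int[mu R]_(x in `[a, t]) g x) g.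
Proof.
move=> Lg; split => // s t a_s st tb.
apply/eqP; rewrite subr_eq addrC; apply/eqP; apply: Rintegral_cat => //.
exact: Linfty_integrable_sub Lg.
Qed.

(** Cutting [[a, b]] into [n] equal pieces bounds the total increment by
    [C (b - a)^2 / n]. *)
Lemma quadratic_increment_constant (R : realType) (a b C : R) (P : R -> R) :
  a <= b ->
  (forall s t, a <= s -> s <= t -> t <= b -> `|P t - P s| <= C * (t - s) ^+ 2) ->
  P b = P a.
Proof.
move=> ab hP; apply/eqP; rewrite -subr_eq0 -normr_le0 leNgt; apply/negP => d0.
have step (n : nat) (k : nat) : (k <= n.+1)%N ->
    `|P (a + k%:R * ((b - a) / n.+1%:R)) - P a| <=
      k%:R * (C * ((b - a) / n.+1%:R) ^+ 2).
  have n0 : 0 < n.+1%:R :> R by rewrite ltr0n.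
  have h0 : 0 <= (b - a) / n.+1%:R by rewrite divr_ge0// subr_ge0.
  elim: k => [_|k ih kn]; first by rewrite !mul0r addr0 subrr normr0.
  have /ih{}ih := ltnW kn.
  rewrite -(subrKA (P (a + k%:R * ((b - a) / n.+1%:R)))).
  apply: (le_trans (ler_normD _ _)); rewrite -natr1 [leRHS]mulrDl mul1r addrC.
  rewrite lerD//.
  apply: (le_trans (hP _ _ _ _ _)).
  - by rewrite lerDl mulr_ge0.
  - by rewrite lerD2l ler_wpM2r// lerDl.
  - rewrite [leRHS](_ : b = a + n.+1%:R * ((b - a) / n.+1%:R)).
      by rewrite lerD2l natr1 ler_wpM2r// ler_nat.
    by rewrite [_ * (_ / _)]mulrC divfK ?gt_eqF// addrC subrK.
  - by rewrite le_eqVlt; apply/orP; left; apply/eqP; congr (_ * _ ^+ _); ring.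
have C0 : 0 <= `|C| * (b - a) ^+ 2 by rewrite mulr_ge0// sqr_ge0.
pose n := Num.bound (`|P b - P a|^-1 * (`|C| * (b - a) ^+ 2)).
have n0 : 0 < n.+1%:R :> R by rewrite ltr0n.
have := step n n.+1 (leqnn _).
rewrite (_ : a + n.+1%:R * ((b - a) / n.+1%:R) = b); last first.
  by rewrite [_ * (_ / _)]mulrC divfK ?gt_eqF// addrC subrK.
apply/negP; rewrite -ltNge.
apply: (@le_lt_trans _ _ (`|C| * (b - a) ^+ 2 / n.+1%:R)).
  rewrite (_ : n.+1%:R * _ = C * (b - a) ^+ 2 / n.+1%:R).
    by rewrite ler_wpM2r ?invr_ge0 ?(ltW n0)// ler_wpM2r ?sqr_ge0// ler_norm.
  by field; rewrite gt_eqF.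
rewrite ltr_pdivrMr// -ltr_pdivrMl//.
apply: (@lt_le_trans _ _ n%:R); last by rewrite ler_nat.
by rewrite archi_boundP// mulr_ge0.
Qed.

(** With [Q] the integral of [g h + f k], the increment of [f h - Q] over [[s, t]]
    is the integral of [g(x) (h(s) - h(x)) + (f(t) - f(x)) k(x)], which is
    [O((t - s)^2)] since [f] and [h] are Lipschitz and [g], [k] are bounded. *)
Lemma primitiveM (R : realType) (a b : R) (f h g k : R -> R) :
  primitive a b f g -> primitive a b h k ->
  primitive a b (fun t => f t * h t) (fun t => g t * h t + f t * k t).
Proof.
move=> fg hk; have [Lg fgE] := fg; have [Lk hkE] := hk.
have Lf := primitive_Linfty fg; have Lh := primitive_Linfty hk.
have L0 : Linfty `[a, b] (fun t => g t * h t + f t * k t).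
  by apply: LinftyD; apply: LinftyM.
split => // c d ac cd db.
have [_ QE] := primitive_integral (Linfty_subitv ac db L0).
pose Q t := \int[mu R]_(x in `[c, t])
  (g x * h x + f x * k x).
have [Lf0 Lf0_ge0 fL] := primitive_lip fg.
have [Lh0 Lh0_ge0 hL] := primitive_lip hk.
have [_ [Mg hMg]] := Lg; have [_ [Mk hMk]] := Lk.
have key := @quadratic_increment_constant R c d (`|Mg| * Lh0 + Lf0 * `|Mk|)
  (fun t => f t * h t - Q t) cd.
suff /key/eqP : forall s t, c <= s -> s <= t -> t <= d ->
    `|f t * h t - Q t - (f s * h s - Q s)|
      <= (`|Mg| * Lh0 + Lf0 * `|Mk|) * (t - s) ^+ 2.
  rewrite -subr_eq0 => /eqP E.
  have -> : f d * h d - f c * h c = Q d - Q c by move: E => /= E; lra.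
  by rewrite /Q QE.
move=> s t cs st td.
have a_s := le_trans ac cs; have tb := le_trans td db.
have -> : f t * h t - Q t - (f s * h s - Q s) =
    (f t - f s) * h s + f t * (h t - h s) - (Q t - Q s) by ring.
rewrite /Q QE// fgE// hkE//.
have ist := Linfty_integrable_sub a_s tb.
have mst := @measurable_itvL R `[s, t].
have -> : (\int[mu R]_(x in `[s, t]) g x) * h s +
   f t * (\int[mu R]_(x in `[s, t]) k x) -
   \int[mu R]_(x in `[s, t]) (g x * h x + f x * k x) =
   \int[mu R]_(x in `[s, t])
     (g x * h s + f t * k x - (g x * h x + f x * k x)).
  rewrite RintegralB//; last 2 first.
  - by apply: ist; apply: LinftyD; apply: LinftyM => //; exact: Linfty_cst.
  - exact: ist.
  congr (_ - _); rewrite RintegralD//; last 2 first.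
  - by apply: ist; apply: LinftyM => //; exact: Linfty_cst.
  - by apply: ist; apply: LinftyM => //; exact: Linfty_cst.
  by rewrite RintegralZr ?RintegralZl//; exact: ist.
have LD : Linfty `[a, b] (fun x => g x * h s + f t * k x + - 1 * (g x * h x + f x * k x)).
  by apply: LinftyD; [apply: LinftyD; apply: LinftyM => //; exact: Linfty_cst|exact: LinftyZ].
have ts : 0 <= t - s by rewrite subr_ge0.
have C0 : 0 <= (`|Mg| * Lh0 + Lf0 * `|Mk|) * (t - s).
  by rewrite mulr_ge0// addr_ge0// mulr_ge0.
have := @norm_Rintegral_le R s t ((`|Mg| * Lh0 + Lf0 * `|Mk|) * (t - s))
  (fun x => g x * h s + f t * k x - (g x * h x + f x * k x)) st.
move=> /(_ _ _)/le_trans; apply.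
- apply: eq_measurable_fun (Linfty_subitv a_s tb LD).1 => x _.
  by rewrite mulN1r.
- apply: (ae_imply2 hMg hMk) => x hg hk' stx.
  have abx := sub_itvcc a_s tb stx.
  have {hg} hg := hg abx; have {hk'} hk' := hk' abx.
  move: abx stx; rewrite /= !in_itv/= => abx /andP[sx xt].
  have -> : g x * h s + f t * k x - (g x * h x + f x * k x) =
    g x * (h s - h x) + (f t - f x) * k x by ring.
  apply: (le_trans (ler_normD _ _)); rewrite !normrM mulrDl lerD//.
    rewrite -mulrA ler_pM//; first by rewrite (le_trans hg)// ler_norm.
    apply: (le_trans (hL _ _ abx _)); first by rewrite a_s (le_trans st).
    by rewrite ler_wpM2l// distrC ger0_norm ?subr_ge0// lerD2r.
  rewrite mulrAC ler_pM//; last by rewrite (le_trans hk')// ler_norm.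
  apply: (le_trans (fL _ _ abx _)); first by rewrite tb (le_trans a_s).
  by rewrite ler_wpM2l// ger0_norm ?subr_ge0// lerD2l lerN2.
by rewrite ger0_norm// expr2 mulrA.
Qed.

Lemma primitive_C1 (R : realType) (a b : R) (h k : R -> R) :
  (forall x : R, is_derive x (1 : R) h (k x)) -> continuous k -> primitive a b h k.
Proof.
move=> dh ck.
have ck' (c d : R) : {within `[c, d], continuous k} by exact: continuous_subspaceT.
split; first exact: continuous_Linfty.
move=> s t _ st _; move: st; rewrite le_eqVlt => /predU1P[->|st].
  have [mk [M hM]] := continuous_Linfty (ck' t t).
  have := norm_Rintegral_le (lexx t) mk hM.
  by rewrite (subrr t) mulr0 normr_le0 (subrr (h t)) => /eqP ->.
have [_ ->] := integral_lebesgue_borel (measurable_itv `[s, t])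
  (subspace_continuous_measurable_fun (measurable_itv `[s, t]) (ck' s t))
  (Linfty_integrable (continuous_Linfty (ck' s t))).
rewrite /Rintegral (@continuous_FTC2 _ k h)//.
- have ch : continuous h.
    by move=> x; apply/differentiable_continuous/derivable1_diffP; case: (dh x).
  split; first by move=> x _; case: (dh x).
  + exact/cvg_at_right_filter/ch.
  + exact/cvg_at_left_filter/ch.
- by move=> x _; rewrite derive1E; case: (dh x).
Qed.

(** * Lebesgue differentiation and obstacles *)

Lemma lebesgue_set_borel (R : realType) (A : set R) :
  @measurable _ (lebesgueR R) A ->
  exists B, @measurable _ (borelR R) B /\
    {ae mu R, forall t, B t <-> A t}.
Proof.
have := @completed_caratheodory_measurable R; rewrite g_sigma_completed_algebra_genE.
move=> E mA; have : completed_algebra_gen (@lebesgue_measure R) A by rewrite E.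
case=> B mB [N [N' [mN' N'0 NN']] <-]; exists B; split => //.
exists N'; split => //; first exact: borel_lebesgue.
by move=> t /= ht; apply: NN'; apply: contrapT => nN; apply: ht; split; [left|case].
Qed.

Lemma ae_rat (R : realType) (P : rat -> R -> Prop) :
  (forall q, {ae mu R, forall t, P q t}) ->
  {ae mu R, forall t, forall q, P q t}.
Proof.
move=> hP.
have : {ae mu R, forall t, forall n : nat,
    forall q, unpickle n = Some q -> P q t}.
  apply: ae_foralln => n; case: (unpickle n) => [q|]; last by apply: aeW.
  by apply: (ae_imply (hP q)) => t Pqt _ [<-].
move/ae_imply; apply => t Pt q; exact: (Pt (pickle q) q (pickleK q)).
Qed.

(** Replace each superlevel set [{f > q}], [q] rational, by a Borel set [B q] that
    agrees with it almost everywhere, and take [g(t) = sup {q | t in B q}]. *)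
Lemma borel_version (R : realType) (D : set R) (f : R -> R) :
  @measurable _ (lebesgueR R) D ->
  @measurable_fun _ _ (lebesgueR R) R D f ->
  exists2 g, @measurable_fun _ _ (borelR R) R setT g &
    {ae mu R, forall t, D t -> g t = f t}.
Proof.
move=> mD mf.
have /choice[B hB] : forall q : rat, exists B : set R, @measurable _ (borelR R) B /\
    {ae mu R, forall t,
      B t <-> (D `&` f @^-1` `]ratr q, +oo[) t}.
  move=> q.
  by apply: lebesgue_set_borel; apply: mf => //; exact: measurable_itv.
pose g (t : R) : \bar R := ereal_sup [set (ratr q)%:E | q in [set q | B q t]].
exists (fine \o g).
  apply: measurableT_comp; first exact: fine_measurable.
  apply: (measurability _ (ErealGenOInfty.measurableE R)).
  move=> /= _ [_ [c ->]] <-; rewrite setTI.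
  rewrite [X in measurable X](_ : _ = \bigcup_q (if (c < ratr q)%R then B q else set0)).
    by apply: bigcupT_measurable_rat => q; case: ifPn => // _; case: (hB q).
  apply/seteqP; split => t /=; rewrite in_itv/= andbT.
    move=> /ereal_sup_gt[_ [q Bqt <-]]; rewrite lte_fin => cq.
    by exists q => //; rewrite cq.
  case=> q _; case: ifPn => // cq Bqt.
  by apply: (@lt_le_trans _ _ (ratr q)%:E) => //; apply: ereal_sup_ubound; exists q.
have : {ae mu R, forall t, forall q,
    B q t <-> (D `&` f @^-1` `]ratr q, +oo[) t}.
  by apply: ae_rat => q; case: (hB q).
move/ae_imply; apply => t Bt Dt /=.
have -> // : g t = (f t)%:E.
apply/eqP; rewrite eq_le; apply/andP; split.
  apply: ub_ereal_sup => _ [q Bq <-].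
  by move/Bt : Bq => [_] /=; rewrite in_itv/= andbT lee_fin => /ltW.
apply/lee_subgt0Pr => e e0.
have [q] : exists q, ratr q \in `]f t - e, f t[%R.
  by apply: rat_in_itvoo; rewrite ltrBlDr ltrDl.
rewrite in_itv/= => /andP[eq qf].
apply: (@le_trans _ _ (ratr q)%:E); first by rewrite -EFinB lee_fin ltW.
apply: ereal_sup_ubound; exists q => //; apply/Bt; split => //=.
by rewrite in_itv/= andbT.
Qed.

Lemma lebesgue_negligible_completed (R : realType) (N : set R) :
  (@lebesgue_measure R).-negligible N ->
  (mu R).-negligible N.
Proof. by case=> B [mB B0 NB]; exists B; split => //; exact: borel_lebesgue. Qed.

(** Only differentiability at [x] itself is available when the lemma is applied
    to an indefinite integral at a Lebesgue point. *)
Lemma derive_at_min0 (R : realType) (F : R -> R) (x e : R) :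
  0 < e -> (forall y, `|y - x| < e -> F x <= F y) -> derivable F x 1 ->
  derive1 F x = 0.
Proof.
move=> e0 Fmin dF.
have qd : (fun h => h^-1 *: (F (h + x) - F x)) @ 0^' --> derive1 F x.
  have := dF; rewrite /derivable => /cvg_ex[l hl].
  have -> : derive1 F x = l by rewrite derive1E; exact/cvg_lim.
  move: hl; apply: cvg_trans; apply: near_eq_cvg; apply: nearW => h.
  by rewrite /= [_%:A]mulr1.
(* A derivative of either sign is contradicted by a difference quotient of the
   opposite sign, found arbitrarily close to [0] on one side. *)
have small (r : R) : 0 < r -> exists2 h, 0 < h & h < r /\ h < e.
  move=> r0; exists (Num.min r e / 2); first by rewrite divr_gt0// lt_min r0.
  have m0 : 0 < Num.min r e by rewrite lt_min r0.
  have : Num.min r e / 2 < Num.min r e by rewrite ltr_pdivrMr// ltr_pMr// ltr1n.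
  by rewrite lt_min => /andP[].
apply/eqP; apply: contraT; rewrite neq_lt => /orP[|] d0.
- have [r /= r0 hr] := ((cvgrPdist_lt _ _).1 qd) (- derive1 F x) (ltac:(by rewrite oppr_gt0)).
  have [h h0 [hlr hle]] := small r r0.
  have := hr h; rewrite /= sub0r normrN gtr0_norm// gt_eqF// => /(_ hlr isT).
  have q0 : 0 <= h^-1 *: (F (h + x) - F x).
    by rewrite mulr_ge0 ?invr_ge0 ?(ltW h0)// subr_ge0 Fmin// addrK gtr0_norm.
  rewrite ltNge => /negP; case.
  by rewrite ler0_norm; lra.
- have [r /= r0 hr] := ((cvgrPdist_lt _ _).1 qd) (derive1 F x) d0.
  have [h h0 [hlr hle]] := small r r0.
  have := hr (- h); rewrite /= sub0r normrN normrN gtr0_norm// oppr_eq0 gt_eqF//.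
  move=> /(_ hlr isT).
  have q0 : (- h)^-1 *: (F (- h + x) - F x) <= 0.
    rewrite invrN scaleNr oppr_le0 mulr_ge0 ?invr_ge0 ?(ltW h0)// subr_ge0 Fmin//.
    by rewrite addrK normrN gtr0_norm.
  rewrite ltNge => /negP; case.
  by rewrite ger0_norm; lra.
Qed.

(** By Lebesgue differentiation [f] is differentiable with derivative [g] at
    almost every point, and a nonnegative function has derivative [0] wherever it
    vanishes and is differentiable. Lebesgue points are taken for a Borel version
    [k] of [g]. *)
Lemma derivative_zero_at_minimum (R : realType) (a b : R) (f g : R -> R) :
  (mu R).-integrable `[a, b] (EFin \o g) ->
  (forall t, a <= t <= b ->
    f t - f a = \int[mu R]_(x in `[a, t]) g x) ->
  (forall t, a <= t <= b -> 0 <= f t) ->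
  {ae mu R, forall t, a < t < b -> f t = 0 -> g t = 0}.
Proof.
move=> ig fg f0.
have mi := @measurable_itvL R.
have mg : @measurable_fun _ _ (lebesgueR R) R `[a, b] g.
  by apply/measurable_EFinP; exact: measurable_int ig.
have [k mk kg] := borel_version (mi `[a, b]) mg.
have mkD D : @measurable_fun _ _ (borelR R) R D k by exact: measurable_funTS.
have mkL D : @measurable _ (borelR R) D -> @measurable_fun _ _ (lebesgueR R) R D k.
  by move=> mD; exact: borel_lebesgue_fun.
have ik : (mu R).-integrable `[a, b] (EFin \o k).
  apply/integrableP; split.
    by apply/measurable_EFinP/mkL; exact: measurable_itv.
  have /integrableP[_] := ig; congr (_ < _)%E; apply: ge0_ae_eq_integral.
  - exact: mi.
  - exact: (measurableT_comp (@abse_measurable R setT) (measurable_int _ ig)).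
  - apply: (measurableT_comp (@abse_measurable R setT)).
    by apply/measurable_EFinP/mkL; exact: measurable_itv.
  - by move=> t _; exact: abse_ge0.
  - by move=> t _; exact: abse_ge0.
  - by apply: (ae_imply kg) => t + Dt => /(_ Dt) /= ->.
have [ikB _] := integral_lebesgue_borel (measurable_itv `[a, b]) (mkD _) ik.
pose K := k \_ `[a, b].
(* Lebesgue points are defined for functions on the whole line. *)
have locK : locally_integrable setT K by apply: integrable_locally => //; exact: measurable_itv.
pose F y := \int[@lebesgue_measure R]_(t in `[a, y]) K t.
have fF t : a <= t <= b -> f t = f a + F t.
  move=> atb; apply/eqP; rewrite addrC -subr_eq fg//; apply/eqP.
  have /andP[at_ tb] := atb.
  have sub : `[a, t]%classic `<=` `[a, b]%classic.
    by apply: subset_itvl; rewrite bnd_simp.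
  have ikt : (mu R).-integrable `[a, t] (EFin \o k).
    by apply: integrableS ik.
  transitivity (\int[mu R]_(x in `[a, t]) k x).
    apply/esym/ae_eq_Rintegral; first exact: mi.
    - by apply: (ae_imply kg) => x + /sub.
    - by apply: mkL; exact: measurable_itv.
  have [_ ->] := integral_lebesgue_borel (measurable_itv `[a, t]) (mkD _) ikt.
  apply: eq_Rintegral => x; rewrite inE => /sub xab.
  by rewrite /K patchE mem_set.
have iK : (@lebesgue_measure R).-integrable `[a, b] (EFin \o K).
  apply: eq_integrable ikB => // x; rewrite inE => xab.
  by rewrite /K /= patchE mem_set.
have /lebesgue_negligible_completed ptK := lebesgue_differentiation locK.
apply: (ae_imply2 ptK kg) => t ptt kgt /andP[at_ tb] ft0.
have tab : `[a, b]%classic t by rewrite /= in_itv/= !ltW.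
rewrite -kgt//.
have [dF FK] := @FTC1_lebesgue_pt R K (BLeft a) t b tb iK (ltac:(by rewrite lte_fin)) ptt.
have : derive1 F t = 0.
  apply: (@derive_at_min0 _ _ _ (Num.min (t - a) (b - t))) => //.
    by rewrite lt_min !subr_gt0 at_.
  move=> y; rewrite lt_min => /andP[y1 y2].
  have yab : a <= y <= b.
    by clear -y1 y2; move: y1 y2; rewrite !ltr_norml => /andP[y1 _] /andP[_ y2]; apply/andP; split; lra.
  have ftt : f a + F t = 0 by rewrite -fF ?ltW ?at_.
  by rewrite -(lerD2l (f a)) ftt -fF//; exact: f0.
by rewrite FK /K patchE mem_set.
Qed.

(** * A smooth step function *)

(** [n]-fold differentiability, by recursion on the derivative: closure properties
    then follow by induction on [n], the Leibniz rule reducing [n.+1] to [n]. *)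
Fixpoint Cn (R : realType) (n : nat) (f : R -> R) : Prop :=
  if n is m.+1 then (forall x, derivable f x 1) /\ Cn m (derive1 f) else True.

Lemma Cn_le (R : realType) n (f : R -> R) : Cn n.+1 f -> Cn n f.
Proof.
elim: n f => // n ih f [df cf]; split => //.
by apply: ih; exact: cf.
Qed.

Lemma CnP (R : realType) n (f f' : R -> R) :
  (forall x : R, is_derive x (1 : R) f (f' x)) -> Cn n f' -> Cn n.+1 f.
Proof.
move=> df cf; split; first by move=> x; case: (df x).
rewrite (_ : derive1 f = f')//.
by apply/funext => x; rewrite derive1E; case: (df x).
Qed.

Lemma Cn_is_derive (R : realType) n (f : R -> R) : Cn n.+1 f ->
  forall x : R, is_derive x (1 : R) f (derive1 f x).
Proof. by case=> df _ x; rewrite derive1E; exact: derivableP. Qed.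

Lemma Cn_cst (R : realType) n (c : R) : Cn n (fun=> c).
Proof.
elim: n c => // n ih c; apply: (@CnP _ _ _ (fun=> 0)) => // x.
Qed.

Lemma CnD (R : realType) n (f g : R -> R) :
  Cn n f -> Cn n g -> Cn n (fun x => f x + g x).
Proof.
elim: n f g => // n ih f g cf cg.
apply: (@CnP _ _ _ (fun x => derive1 f x + derive1 g x)).
  by move=> x; exact: (is_deriveD (Cn_is_derive cf x) (Cn_is_derive cg x)).
by apply: ih; [case: cf|case: cg].
Qed.

Lemma CnM (R : realType) n (f g : R -> R) :
  Cn n f -> Cn n g -> Cn n (fun x => f x * g x).
Proof.
elim: n f g => // n ih f g cf cg.
apply: (@CnP _ _ _ (fun x => f x * derive1 g x + g x * derive1 f x)).
  by move=> x; exact: (is_deriveM (Cn_is_derive cf x) (Cn_is_derive cg x)).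
by apply: CnD; apply: ih; rewrite ?(Cn_le cf) ?(Cn_le cg)//;
  [exact: Cn_le|case: cg|exact: Cn_le|case: cf].
Qed.

Lemma CnV (R : realType) n (f : R -> R) :
  (forall x, f x != 0) -> Cn n f -> Cn n (fun x => (f x)^-1).
Proof.
move=> f0; elim: n => // n ih cf.
apply: (@CnP _ _ _ (fun x => (- 1) * ((f x)^-1 * (f x)^-1 * derive1 f x))).
  move=> x; apply: (is_derive_eq (is_deriveV (f0 x) (Cn_is_derive cf x))).
  by rewrite expr2 invfM mulN1r scaleNr.
apply: CnM; first exact: Cn_cst.
apply: CnM; last by case: cf.
by apply: CnM; apply: ih; exact: Cn_le.
Qed.

Lemma is_derive_affine (R : realType) (c d x : R) :
  is_derive x (1 : R) (fun x => c * x + d) c.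
Proof.
have : is_derive x (1 : R) (fun x => c * x + d) (c * 1 + 0).
  by apply: is_deriveD; apply: is_deriveZ.
by rewrite mulr1 addr0.
Qed.

Lemma Cn_affine (R : realType) n (c d : R) (f : R -> R) :
  Cn n f -> Cn n (fun x => f (c * x + d)).
Proof.
elim: n f => // n ih f cf.
apply: (@CnP _ _ _ (fun x => derive1 f (c * x + d) * c)).
  move=> x; apply: (@is_derive1_comp _ f (fun x => c * x + d)).
    exact: Cn_is_derive cf _.
  exact: is_derive_affine.
by apply: CnM; [apply: ih; case: cf|exact: Cn_cst].
Qed.

Lemma Cn_derive1n (R : realType) (f : R -> R) : (forall n, Cn n f) ->
  forall n x, derivable (derive1n n f) x 1.
Proof.
move=> cf n x.
have : Cn 1 (derive1n n f).
  elim: n f cf => [f cf|n ih f cf]; first exact: cf.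
  by rewrite /derive1n iterSr; apply: ih => m; have [] := cf m.+1.
by case=> + _; exact.
Qed.

(** Each monomial satisfies [y^i exp(-y) <= i!], by the exponential series. *)
Lemma poly_expRN_bounded (R : realType) (p : {poly R}) :
  exists2 C, 0 <= C & forall y, 0 <= y -> `|p.[y]| * expR (- y) <= C.
Proof.
exists (\sum_(i < size p) `|p`_i| * i`!%:R).
  by apply: sumr_ge0 => i _; rewrite mulr_ge0.
move=> y y0; rewrite horner_coef.
apply: (@le_trans _ _ (\sum_(i < size p) (`|p`_i| * y ^+ i) * expR (- y))).
  rewrite -mulr_suml ler_wpM2r ?expR_ge0//.
  apply: (le_trans (ler_norm_sum _ _ _)); apply: ler_sum => i _.
  by rewrite normrM normrX (ger0_norm y0).
apply: ler_sum => i _; rewrite -mulrA ler_wpM2l// expRN ler_pdivrMr ?expR_gt0//.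
have f0 : (0 : R) < i`!%:R by rewrite ltr0n fact_gt0.
rewrite mulrC -ler_pdivrMr//; case: i f0 => [[|i] /= _] f0.
  by rewrite expr0 fact0 divr1 -expR0 ler_expR.
by apply: le_trans (expR_ge1Dxn i y0); rewrite lerDr.
Qed.

(** All derivatives of [exp (-1/x)] have this form, whence the polynomial factor. *)
Definition flat (R : realType) (p : {poly R}) (x : R) : R :=
  if 0 < x then p.[x^-1] * expR (- x^-1) else 0.

(** Apart from the chain rule, the point [0] needs [p(1/h) exp(-1/h) / h = O(h)].
    The family being closed under differentiation, all its members are smooth. *)
Lemma flat_derive (R : realType) (p : {poly R}) (x : R) :
  is_derive x (1 : R) (flat p) (flat ('X^2 * (p - p^`())) x).
Proof.
case: (ltgtP x 0) => x0.
- rewrite [flat ('X^2 * _) x]/flat ltNge (ltW x0)/=.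
  apply: (@near_eq_is_derive _ _ _ (cst 0)).
  near=> y; rewrite /flat ltNge (_ : y <= 0)//=.
  by apply: ltW; near: y; exact: lt_nbhsl.
- rewrite [flat ('X^2 * _) x]/flat x0.
  apply: (@near_eq_is_derive R R R (fun y : R => p.[y^-1] * expR (- y^-1))).
    near=> y; rewrite /flat (_ : 0 < y)//=.
    by near: y; exact: lt_nbhsr.
  have xn0 : x != 0 by rewrite gt_eqF.
  have dV : is_derive x (1 : R) (fun y => y^-1) (- x ^- 2).
    apply: (is_derive_eq (is_deriveV xn0 (is_derive_id x (1 : R)))).
    by rewrite scaleNr [_ *: _]mulr1.
  have dp := @is_derive1_comp _ (horner p) (fun y => y^-1) x _ _ _ dV.
  have dN : is_derive x (1 : R) (fun y => - y^-1) (x ^- 2).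
    by have := is_deriveN dV; rewrite opprK.
  have de := @is_derive1_comp _ expR (fun y => - y^-1) x _ _ _ dN.
  apply: (is_derive_eq (is_deriveM (dp _ (is_derive_poly p _)) (de _ (is_derive_expR _)))).
  by rewrite /GRing.scale/= !hornerE /=; field.
- rewrite x0 [flat ('X^2 * _) 0]/flat ltxx.
  have [C C0 hC] := poly_expRN_bounded (p * 'X^2).
  have q0 : (fun h => h^-1 *: (flat p (h%:A + 0) - flat p 0)) @ 0^' --> (0 : R).
    apply/cvgrPdist_lt => e e0; near=> h.
    rewrite [h%:A]mulr1 addr0 [flat p 0]/flat ltxx subr0 sub0r normrN.
    apply: (@le_lt_trans _ _ (C * `|h|)).
      rewrite /flat; case: ifPn => h0; last by rewrite scaler0 normr0 mulr_ge0.
      have hi0 : 0 <= h^-1 by rewrite invr_ge0 ltW.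
      have := hC _ hi0; rewrite hornerM hornerXn normrM => hCh.
      rewrite normrM normrM (ger0_norm (expR_ge0 _)) (gtr0_norm h0) (ger0_norm hi0).
      rewrite -ler_pdivrMr//; apply: le_trans hCh.
      rewrite normrX (ger0_norm hi0).
      by rewrite le_eqVlt; apply/orP; left; apply/eqP; ring.
    apply: (@le_lt_trans _ _ ((C + 1) * `|h|)); first by rewrite ler_wpM2r// lerDl.
    rewrite -ltr_pdivlMl; last by rewrite ltr_wpDl.
    near: h; apply/nbhs_ballP; exists ((C + 1)^-1 * e) => /=.
      by rewrite mulr_gt0// invr_gt0 ltr_wpDl.
    by move=> h; rewrite /ball/= sub0r normrN.
  by apply: DeriveDef; [apply/cvg_ex; exists 0|exact/cvg_lim].
Unshelve. all: by end_near. Qed.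

Lemma Cn_flat (R : realType) n (p : {poly R}) : Cn n (flat p).
Proof. by elim: n p => // n ih p; apply: CnP; [exact: flat_derive|exact: ih]. Qed.

Lemma flat1_gt0 (R : realType) (x : R) : 0 < x -> 0 < flat 1 x.
Proof. by move=> x0; rewrite /flat x0 hornerE mul1r expR_gt0. Qed.

Lemma flat1_ge0 (R : realType) (x : R) : 0 <= flat 1 x.
Proof.
case: (ltP 0 x) => [/flat1_gt0/ltW//|x0].
by rewrite /flat ltNge x0.
Qed.

Lemma flat_le0 (R : realType) (p : {poly R}) (x : R) : x <= 0 -> flat p x = 0.
Proof. by move=> x0; rewrite /flat ltNge x0. Qed.

Definition smooth_step (R : realType) (x : R) : R :=
  flat 1 x * (flat 1 x + flat 1 (-1 * x + 1))^-1.

Lemma smooth_step_denom_gt0 (R : realType) (x : R) :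
  0 < flat 1 x + flat 1 (-1 * x + 1).
Proof.
case: (ltP 0 x) => x0; first by rewrite ltr_pwDl ?flat1_gt0 ?flat1_ge0.
by rewrite ltr_wpDl ?flat1_ge0// flat1_gt0// mulN1r; lra.
Qed.

Lemma Cn_smooth_step (R : realType) n : Cn n (@smooth_step R).
Proof.
apply: CnM; first exact: Cn_flat.
apply: CnV; first by move=> x; rewrite gt_eqF// smooth_step_denom_gt0.
by apply: CnD; [exact: Cn_flat|apply: Cn_affine; exact: Cn_flat].
Qed.

Lemma smooth_step_le0 (R : realType) (x : R) : x <= 0 -> smooth_step x = 0.
Proof. by move=> x0; rewrite /smooth_step flat_le0 ?mul0r. Qed.

Lemma smooth_step_ge1 (R : realType) (x : R) : 1 <= x -> smooth_step x = 1.
Proof.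
move=> x1; rewrite /smooth_step [flat 1 (-1 * x + 1)]flat_le0; last first.
  by rewrite mulN1r; lra.
by rewrite addr0 divff// gt_eqF// flat1_gt0; lra.
Qed.

Lemma smooth_step01 (R : realType) (x : R) : 0 <= smooth_step x <= 1.
Proof.
rewrite /smooth_step; apply/andP; split.
  by rewrite mulr_ge0 ?flat1_ge0 ?invr_ge0 ?ltW ?smooth_step_denom_gt0.
by rewrite ler_pdivrMr ?smooth_step_denom_gt0// mul1r lerDl flat1_ge0.
Qed.

Lemma continuous_derive1_step (R : realType) : continuous (derive1 (@smooth_step R)).
Proof.
move=> x; have [_ [dS _]] := @Cn_smooth_step R 2.
exact/differentiable_continuous/derivable1_diffP.
Qed.

(** At such points the step function attains its minimum or its maximum. *)
Lemma derive1_step_out (R : realType) (x : R) : x <= 0 \/ 1 <= x ->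
  derive1 (@smooth_step R) x = 0.
Proof.
have [dS _] := @Cn_smooth_step R 1.
have xx : x \in `]x - 1, x + 1[ by rewrite in_itv/=; apply/andP; split; lra.
case=> x01; rewrite derive1E.
- have [] // := @derive1_at_min R (@smooth_step R) (x - 1) (x + 1) x.
  + by lra.
  + by move=> t _; rewrite (smooth_step_le0 x01); case/andP: (smooth_step01 t).
- have [] // := @derive1_at_max R (@smooth_step R) (x - 1) (x + 1) x.
  + by lra.
  + by move=> t _; rewrite (smooth_step_ge1 x01); case/andP: (smooth_step01 t).
Qed.

Lemma derive1_step_bounded (R : realType) :
  exists2 C, 0 <= C & forall x : R, 0 <= x <= 1 -> `|derive1 (@smooth_step R) x| <= C.
Proof.
have cS : {within `[0, 1], continuous (derive1 (@smooth_step R))}.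
  exact/continuous_subspaceT/continuous_derive1_step.
have [M [_ hM]] := compact_bounded (continuous_compact cS (@segment_compact R 0 1)).
exists (`|M| + 1) => // x x01; apply: hM; first by rewrite ltr_pwDr// ler_norm.
by exists x => //=; rewrite in_itv.
Qed.

(** * Weak derivatives on an interval *)

(** The argument is [(x - c) / d], in the shape of [Cn_affine]. *)
Definition step_at (R : realType) (c d : R) (x : R) : R :=
  smooth_step (d^-1 * x + - (d^-1 * c)).

Definition dstep_at (R : realType) (c d : R) (x : R) : R :=
  derive1 (@smooth_step R) (d^-1 * x + - (d^-1 * c)) * d^-1.

Lemma step_at_arg (R : realType) (c d x : R) :
  d^-1 * x + - (d^-1 * c) = d^-1 * (x - c).
Proof. by rewrite mulrBr. Qed.

Lemma Cn_step_at (R : realType) n (c d : R) : Cn n (step_at c d).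
Proof. exact/Cn_affine/Cn_smooth_step. Qed.

Lemma step_at_derive (R : realType) (c d x : R) :
  is_derive x (1 : R) (step_at c d) (dstep_at c d x).
Proof.
apply: (@is_derive1_comp _ (@smooth_step R) (fun x => d^-1 * x + - (d^-1 * c))).
  exact: (Cn_is_derive (@Cn_smooth_step R 1)).
exact: is_derive_affine.
Qed.

Lemma continuous_dstep_at (R : realType) (c d : R) : continuous (dstep_at c d).
Proof.
move=> x.
have [_ [dS _]] := @Cn_step_at R 2 c d.
have -> : dstep_at c d = derive1 (step_at c d).
  by apply/funext => y; rewrite derive1E; case: (step_at_derive c d y).
exact/differentiable_continuous/derivable1_diffP.
Qed.

Lemma step_at_le (R : realType) (c d x : R) : 0 < d -> x <= c -> step_at c d x = 0.
Proof.
move=> d0 xc; rewrite /step_at step_at_arg smooth_step_le0//.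
by rewrite mulr_ge0_le0 ?invr_ge0 ?(ltW d0)// subr_le0.
Qed.

Lemma step_at_ge (R : realType) (c d x : R) : 0 < d -> c + d <= x -> step_at c d x = 1.
Proof.
move=> d0 xc; rewrite /step_at step_at_arg smooth_step_ge1//.
by rewrite ler_pdivlMl// mulr1 lerBrDl.
Qed.

Lemma step_at01 (R : realType) (c d x : R) : 0 <= step_at c d x <= 1.
Proof. exact: smooth_step01. Qed.

Lemma dstep_at_out (R : realType) (c d x : R) : 0 < d -> x <= c \/ c + d <= x ->
  dstep_at c d x = 0.
Proof.
move=> d0 xc; rewrite /dstep_at step_at_arg derive1_step_out ?mul0r//.
case: xc => xc; [left|right].
  by rewrite mulr_ge0_le0 ?invr_ge0 ?(ltW d0)// subr_le0.
by rewrite ler_pdivlMl// mulr1 lerBrDl.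
Qed.

(** The weight [dstep_at c d] lives on [[c, c + d]], has integral [1] and absolute
    value at most [C / d]. *)
Lemma step_average (R : realType) (a b c d v e C : R) (u : R -> R) :
  (forall x : R, 0 <= x <= 1 -> `|derive1 (@smooth_step R) x| <= C) ->
  0 < d -> a <= c -> c + d <= b -> 0 <= C ->
  {within `[a, b], continuous u} ->
  (forall x, c <= x <= c + d -> `|u x - v| <= e) ->
  `|\int[mu R]_(x in `[a, b]) (dstep_at c d x * u x) - v|
    <= C * e.
Proof.
move=> hC d0 ac cdb C0 cu hu.
have dI0 : 0 <= d^-1 by rewrite invr_ge0 ltW.
have ccd : c <= c + d by rewrite lerDl ltW.
have ab : a <= b by rewrite (le_trans ac)// (le_trans ccd).
have e0 : 0 <= e by apply: le_trans (hu c _) => //; rewrite lexx.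
have [Ls sE] := primitive_C1 a b (step_at_derive c d) (@continuous_dstep_at R c d).
have Lu := continuous_Linfty cu.
have int1 : \int[mu R]_(x in `[a, b]) dstep_at c d x = 1.
  by rewrite -sE// step_at_ge// step_at_le// subr0.
pose w x := dstep_at c d x * u x - v * dstep_at c d x.
have Lw : Linfty `[a, b] w.
  have := LinftyD (LinftyM Ls Lu) (LinftyZ (- v) Ls).
  by congr Linfty; apply/funext => x; rewrite /w mulNr.
have -> : \int[mu R]_(x in `[a, b]) (dstep_at c d x * u x) - v
   = \int[mu R]_(x in `[a, b]) w x.
  rewrite RintegralB; last 3 first.
  - exact: measurable_itvL.
  - exact/Linfty_integrable/LinftyM.
  - exact/Linfty_integrable/LinftyZ.
  congr (_ - _); rewrite RintegralZl; last 2 first.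
  - exact: measurable_itvL.
  - exact/Linfty_integrable.
  by rewrite int1 mulr1.
rewrite (Rintegral_cat ac (le_trans ccd cdb)); last exact: Linfty_integrable.
rewrite (Rintegral_cat ccd cdb); last exact: Linfty_integrable_sub Lw.
have w0 x : x <= c \/ c + d <= x -> w x = 0.
  by move=> h; rewrite /w dstep_at_out// mulr0 mul0r subrr.
have -> : \int[mu R]_(x in `[a, c]) w x = 0.
  rewrite (@eq_Rintegral _ _ _ _ _ (fun=> 0)).
    by rewrite Rintegral_cst ?mul0r//; exact: measurable_itvL.
  by move=> x; rewrite inE/= in_itv/= => /andP[_ xc]; apply: w0; left.
have -> : \int[mu R]_(x in `[c + d, b]) w x = 0.
  rewrite (@eq_Rintegral _ _ _ _ _ (fun=> 0)).
    by rewrite Rintegral_cst ?mul0r//; exact: measurable_itvL.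
  by move=> x; rewrite inE/= in_itv/= => /andP[xc _]; apply: w0; right.
rewrite add0r addr0.
have [mw _] := Linfty_subitv ac cdb Lw.
have := @norm_Rintegral_le R c (c + d) (C * d^-1 * e) w ccd mw.
move=> /(_ _)/le_trans; apply.
  apply: aeW => x /=; rewrite in_itv/= => xcd.
  have -> : w x = dstep_at c d x * (u x - v) by rewrite /w; ring.
  rewrite normrM ler_pM ?hu//.
  rewrite /dstep_at normrM (ger0_norm dI0) ler_wpM2r// hC//.
  have /andP[cx xd] := xcd.
  rewrite step_at_arg mulr_ge0 ?subr_ge0//=.
  by rewrite ler_pdivrMl// mulr1 lerBlDl.
rewrite ger0_norm ?mulr_ge0// addrAC subrr add0r.
(* The length [d] of the window cancels the height [C / d] of the weight. *)
rewrite le_eqVlt; apply/orP; left; apply/eqP; field.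
by rewrite gt_eqF.
Qed.

(** For [4 d <= b - a], a smooth approximation of the indicator of [[a, b]] with
    support inside [[a + d, b - d]], equal to [1] on [[a + 2 d, b - 2 d]]. *)
Definition plateau (R : realType) (a b d : R) (x : R) : R :=
  step_at (a + d) d x + - 1 * step_at (b + - (d + d)) d x.

Lemma plateau_derive (R : realType) (a b d x : R) :
  is_derive x (1 : R) (plateau a b d)
    (dstep_at (a + d) d x + - 1 * dstep_at (b + - (d + d)) d x).
Proof.
exact: (is_deriveD (step_at_derive _ _ _)
  (is_deriveZ (-1 : R) (step_at_derive (b + - (d + d)) d x))).
Qed.

Lemma plateau_out (R : realType) (a b d x : R) : 0 < d -> 4 * d <= b - a ->
  x <= a + d \/ b - d <= x -> plateau a b d x = 0.
Proof.
move=> d0 dab; rewrite /plateau; case=> hx.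
  by rewrite !step_at_le//; [ring|lra].
by rewrite !step_at_ge//; [ring|lra|lra].
Qed.

Lemma plateau_in (R : realType) (a b d x : R) : 0 < d ->
  a + 2 * d <= x -> x <= b - 2 * d -> plateau a b d x = 1.
Proof.
move=> d0 ax xb; rewrite /plateau step_at_ge// ?step_at_le//; [by ring|lra|lra].
Qed.

Lemma plateau_norm (R : realType) (a b d x : R) : `|plateau a b d x| <= 1.
Proof.
have /andP[] := step_at01 (a + d) d x; have /andP[] := step_at01 (b + - (d + d)) d x.
by rewrite /plateau ler_norml; move=> ? ? ? ?; apply/andP; split; lra.
Qed.

Lemma plateau_test (R : realType) (a b d : R) : 0 < d -> 4 * d <= b - a ->
  test_function `]a, b[ (plateau a b d).
Proof.
move=> d0 dab.
have sub : closure [set x | plateau a b d x != 0] `<=` `[a + d, b - d].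
  have cl : closed `[a + d, b - d]%classic by exact: interval_closed.
  rewrite [X in _ `<=` X]((closure_id _).1 cl); apply: closure_subset => x /=.
  apply: contraNP => /negP; rewrite in_itv/= negb_and -!ltNge => /orP hx.
  by apply/eqP; apply: plateau_out => //; case: hx => /ltW; [left|right].
split.
- move=> n x; apply: Cn_derive1n => m; apply: CnD; first exact: Cn_step_at.
  by apply: CnM; [exact: Cn_cst|exact: Cn_step_at].
- apply: (subclosed_compact _ (@segment_compact R (a + d) (b - d))) => //.
  exact: closed_closure.
- move=> x /sub; rewrite /= !in_itv/= => /andP[ax xb]; apply/andP; split; lra.
Qed.

Lemma step_average_cvg (R : realType) (a b p : R) (c d : nat -> R) (u : R -> R) :
  a <= p <= b -> d n @[n --> \oo] --> (0 : R) ->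
  (forall n, [/\ 0 < d n, a <= c n & c n + d n <= b]) ->
  (forall n x, c n <= x <= c n + d n -> `|p - x| <= 2 * d n) ->
  {within `[a, b], continuous u} ->
  (\int[mu R]_(x in `[a, b])
    (dstep_at (c n) (d n) x * u x)) @[n --> \oo] --> u p.
Proof.
move=> pab d_0 cd near_p cu.
have [C C0 hC] := derive1_step_bounded R.
have C1 : 0 < C + 1 by rewrite ltr_wpDl.
apply/cvgrPdist_le => e e0.
have ei0 : 0 < e / (C + 1) by rewrite divr_gt0.
have pab' : `[a, b]%classic p by rewrite /= in_itv.
have /subspace_continuousP/(_ p pab')/cvgrPdist_le/(_ _ ei0) := cu.
move=> [r /= r0 hr].
have r20 : 0 < r / 2 by rewrite divr_gt0.
near=> n.
have [dn0 acn cdb] := cd n.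
have dr : 2 * d n < r.
  rewrite mulrC -ltr_pdivlMr//.
  rewrite (le_lt_trans (ler_norm _))// -[d n]subr0 distrC.
  by near: n; exact: ((cvgrPdist_lt _ _).1 d_0).
rewrite distrC; apply: (le_trans (step_average hC dn0 acn cdb C0 cu _)).
  move=> x xcd; have /andP[cx xd] := xcd; rewrite distrC; apply: hr.
    by rewrite /ball/=; apply: le_lt_trans dr; exact: near_p.
  by rewrite in_itv/= (le_trans acn cx) (le_trans xd cdb).
by rewrite mulrA ler_pdivrMr// mulrC ler_wpM2l ?(ltW e0)// lerDl.
Unshelve. all: by end_near. Qed.

(** The end points form a null set, and by completeness of the measure they do not
    affect measurability. *)
Lemma integrable_oo_cc (R : realType) (a b : R) (g : R -> R) :
  (mu R).-integrable `]a, b[ (EFin \o g) ->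
  (mu R).-integrable `[a, b] (EFin \o g).
Proof.
move=> ig; have mi := @measurable_itvL R.
have m1 c : @measurable _ (lebesgueR R) [set c] by rewrite -set_itv1; exact: mi.
have mN : @measurable _ (lebesgueR R) (`[a, b] `&` [set a; b]).
  by apply: measurableI => //; apply: measurableU.
have E : `]a, b[%classic = `[a, b]%classic `\` (`[a, b] `&` [set a; b]).
  apply/seteqP; split => x /=; rewrite !in_itv/=.
    move=> /andP[ax xb]; rewrite !ltW//; split => // -[_ [] xE].
      by rewrite xE ltxx in ax.
    by rewrite xE ltxx in xb.
  move=> [/andP[ax xb] h]; rewrite !lt_neqAle ax xb !andbT.
  apply/andP; split; apply/eqP => xE; apply: h; split; rewrite ?ax//.
    by left.
  by right.
have N0 : mu R (`[a, b] `&` [set a; b]) = 0%E.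
  apply/eqP; rewrite eq_le measure_ge0 andbT.
  apply: (@le_trans _ _ (mu R [set a; b])).
    by apply: le_measure; rewrite ?inE//; apply: measurableU.
  apply: (le_trans (measureU2 _ _ _)) => //.
  by rewrite -[leRHS]adde0; apply: leeD; rewrite le_eqVlt (introT eqP (mu_set1 _)).
have mg : @measurable_fun _ _ (lebesgueR R) (\bar R) `[a, b] (EFin \o g).
  apply: (@ae_measurable_fun _ _ _ (mu R)
    (@completed_lebesgue_measure_is_complete R) _ ((EFin \o g) \_ `]a, b[)).
    exists (`[a, b] `&` [set a; b]); split => // x /= /not_implyP[abx gx].
    split => //; apply: contrapT => xN; apply: gx.
    have xoo : `]a, b[%classic x by rewrite E; split => // -[].
    by rewrite patchE mem_set.
  apply/(measurable_restrict _ _ _).1 => //.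
  have mg := measurable_int _ ig.
  by apply: (measurable_funS _ _ mg) => // x [].
by rewrite (negligible_integrable mN)// -E.
Qed.

(** Test the weak derivative against plateaus [phi n] that tend to the indicator of
    the interval. The integral of [phi n * g] tends to that of [g] by dominated
    convergence, while [phi n]' averages [u] near [a] with total weight [1] and
    near [b] with total weight [-1]. No values outside the interval enter, so
    the end points may be end points of the domain of [u]. *)
Lemma weak_derivative_increment (R : realType) (a b : R) (u g : R -> R) :
  a < b -> {within `[a, b], continuous u} ->
  (mu R).-integrable `]a, b[ (EFin \o g) ->
  (forall phi, test_function `]a, b[ phi ->
    \int[mu R]_(t in `]a, b[) (derive1 phi t * u t) =
    - \int[mu R]_(t in `]a, b[) (phi t * g t)) ->
  u b - u a = \int[mu R]_(t in `[a, b]) g t.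
Proof.
move=> ab cu ig weak; have mi := @measurable_itvL R.
pose d (n : nat) : R := (b - a) / 4 / n.+1%:R.
have ba0 : 0 < b - a by rewrite subr_gt0.
have d0 n : 0 < d n by rewrite /d !divr_gt0.
have d4 n : 4 * d n <= b - a.
  rewrite /d mulrA mulrCA divff// mulr1 ler_pdivrMr ?ltr0n//.
  by rewrite ler_peMr ?(ltW ba0)// ler1n.
have d_0 : d n @[n --> \oo] --> (0 : R).
  rewrite /d -[X in _ --> X](mulr0 ((b - a) / 4)).
  by apply: cvgM; [exact: cvg_cst|exact: cvg_harmonic].
pose phi n := plateau a b (d n).
have tphi n : test_function `]a, b[ (phi n) := plateau_test (d0 n) (d4 n).
have lhs : (\int[mu R]_(t in `]a, b[)
    (derive1 (phi n) t * u t)) @[n --> \oo] --> u a - u b.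
  have h1 n : [/\ 0 < d n, a <= a + d n & a + d n + d n <= b].
    by split => //; have := d4 n; have := d0 n; lra.
  have h2 n x : a + d n <= x <= a + d n + d n -> `|a - x| <= 2 * d n.
    by move=> /andP[? ?]; rewrite ler_norml; have := d0 n; lra.
  have h3 n : [/\ 0 < d n, a <= b - (d n + d n) & b - (d n + d n) + d n <= b].
    by split => //; have := d4 n; have := d0 n; lra.
  have h4 n x : b - (d n + d n) <= x <= b - (d n + d n) + d n -> `|b - x| <= 2 * d n.
    by move=> /andP[? ?]; rewrite ler_norml; have := d0 n; lra.
  have aab : a <= a <= b by rewrite lexx ltW.
  have bab : a <= b <= b by rewrite lexx ltW.
  suff -> : (fun n => \int[mu R]_(t in `]a, b[)
      (derive1 (phi n) t * u t)) =
    (fun n => \int[mu R]_(x in `[a, b])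
      (dstep_at (a + d n) (d n) x * u x)) -
    (fun n => \int[mu R]_(x in `[a, b])
      (dstep_at (b - (d n + d n)) (d n) x * u x)).
    exact: cvgB (@step_average_cvg R a b a _ d u aab d_0 h1 h2 cu)
      (@step_average_cvg R a b b _ d u bab d_0 h3 h4 cu).
  apply/funext => n; rewrite fctE.
  have Lu := continuous_Linfty cu.
  have LA := continuous_Linfty (continuous_subspaceT (@continuous_dstep_at R (a + d n) (d n))).
  have LB := continuous_Linfty (continuous_subspaceT (@continuous_dstep_at R (b - (d n + d n)) (d n))).
  rewrite -RintegralB; last 3 first.
  - exact: mi.
  - exact/Linfty_integrable/LinftyM.
  - exact/Linfty_integrable/LinftyM.
  have dE x : derive1 (phi n) x * u x = dstep_at (a + d n) (d n) x * u x -
      dstep_at (b - (d n + d n)) (d n) x * u x.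
    have [_ pE] := plateau_derive a b (d n) x.
    by rewrite derive1E pE mulrDl mulN1r mulNr.
  rewrite (Rintegral_oo_cc); last first.
    apply: Linfty_integrable.
    have := LinftyD (LinftyM (LA a b) Lu) (LinftyZ (-1) (LinftyM (LB a b) Lu)).
    by congr Linfty; apply/funext => x; rewrite dE mulN1r.
  by apply: eq_Rintegral => x _; rewrite dE.
have rhs : (\int[mu R]_(t in `]a, b[) (phi n t * g t))
    @[n --> \oo] --> \int[mu R]_(t in `]a, b[) g t.
  have mg : @measurable_fun _ _ (lebesgueR R) R `]a, b[ g.
    by apply/measurable_EFinP; exact: measurable_int ig.
  have [] := @dominated_convergence _ (lebesgueR R) R (mu R)
    `]a, b[ (mi _) (fun n t => (phi n t * g t)%:E) (EFin \o g) (EFin \o (fun x => `|g x|)).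
  - move=> n; apply/measurable_EFinP; apply: measurable_funM => //.
    apply: continuous_lebesgue_fun; first exact: measurable_itv.
    apply: continuous_subspaceT => x.
    apply/differentiable_continuous/derivable1_diffP.
    by case: (plateau_derive a b (d n) x).
  - exact/measurable_EFinP.
  - apply: aeW => x; rewrite /= in_itv/= => /andP[ax xb].
    apply: cvg_near_cst; have x0 : 0 < Num.min (x - a) (b - x) / 2.
      by rewrite divr_gt0// lt_min !subr_gt0 ax.
    near=> n.
    have : d n < Num.min (x - a) (b - x) / 2.
      rewrite (le_lt_trans (ler_norm _))// -[d n]subr0 distrC.
      by near: n; exact: ((cvgrPdist_lt _ _).1 d_0).
    rewrite ltr_pdivlMr// lt_min => /andP[h1 h2].
    by rewrite /phi plateau_in ?mul1r//; clear -h1 h2; lra.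
  - exact: integrable_norm.
  - apply: aeW => x n _ /=; rewrite lee_fin normrM -[leRHS]mul1r ler_wpM2r//.
    exact: plateau_norm.
  - move=> _ _; rewrite -(fineK (integrable_fin_num (mi _) ig)) => H.
    exact: (fine_cvg H).
have E : u a - u b = - \int[mu R]_(t in `]a, b[) g t.
  apply: (cvg_unique _ lhs) => //.
  rewrite (_ : (fun n => _) = (fun n => - \int[mu R]_(t in `]a, b[) (phi n t * g t))).
    exact: cvgN.
  by apply/funext => n; exact: weak.
rewrite -Rintegral_oo_cc; last exact: integrable_oo_cc.
by rewrite -[RHS]opprK -E opprB.
Unshelve. all: by end_near. Qed.

(** Integrate [(phi f)' = phi' f + phi g]; the test function [phi] vanishes at both
    end points. *)
Lemma primitive_weak_derivative (R : realType) (a b : R) (f g phi : R -> R) :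
  a < b -> primitive a b f g -> test_function `]a, b[ phi ->
  \int[mu R]_(t in `]a, b[) (derive1 phi t * f t) =
    - \int[mu R]_(t in `]a, b[) (phi t * g t).
Proof.
move=> ab fg [dphi _ sub].
have out t : ~ `]a, b[%classic t -> phi t = 0.
  move=> tn; apply/eqP; apply: contrapT => /negP pt; apply: tn; apply: sub.
  exact: subset_closure.
have pphi : primitive a b phi (derive1 phi).
  apply: primitive_C1 => x.
    by rewrite derive1E; apply: derivableP; exact: (dphi 0%N x).
  apply/differentiable_continuous/derivable1_diffP; exact: (dphi 1%N x).
have Lf := primitive_Linfty fg; have Lphi := primitive_Linfty pphi.
have L1 : Linfty `[a, b] (fun t => derive1 phi t * f t) by apply: LinftyM => //; case: pphi.
have L2' : Linfty `[a, b] (fun t => phi t * g t) by apply: LinftyM => //; case: fg.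
have [_ /(_ a b (lexx _) (ltW ab) (lexx _))] := primitiveM pphi fg.
rewrite (out b) ?(out a); last 2 first.
- by rewrite /= in_itv/= ltxx.
- by rewrite /= in_itv/= ltxx andbF.
rewrite !mul0r subrr RintegralD; last 3 first.
- exact: measurable_itvL.
- exact: Linfty_integrable.
- exact: Linfty_integrable.
rewrite !Rintegral_oo_cc; [|exact: Linfty_integrable|exact: Linfty_integrable].
by move/eqP; rewrite eq_sym addr_eq0 => /eqP.
Qed.

(** * Variation of constants *)

Lemma ointegral_primitive (R : realType) (V : finType) (c d : R)
    (f : R -> R) (g : R -> V -> R) (i : V) (t : R) :
  c <= 0 <= d -> c <= t <= d ->
  primitive c d f (fun s => g s i) -> ointegralV 0 t g i = f t - f 0.
Proof.
move=> /andP[c0 d0] /andP[ct td] [_ fE]; rewrite /ointegralV /integralV.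
case: ifPn => [t0|]; first by rewrite fE.
rewrite -ltNge => /ltW t0.
transitivity (- \int[mu R]_(x in `[t, 0]) g x i) => //.
by rewrite -fE// opprB.
Qed.

(** The properties of [k t = exp (t M)] that variation of constants relies on:
    [k 0 = 1] and [k' = k M = M k]. *)
Definition is_matrix_exp (R : realType) (V : finType) (M : V -> V -> R)
    (k : R -> V -> V -> R) : Prop :=
  [/\ forall i j, k 0 i j = (i == j)%:R,
      forall (t : R) i j, is_derive t (1 : R) (fun t => k t i j) (\sum_l k t i l * M l j) &
      forall (t : R) i j, \sum_l k t i l * M l j = \sum_l M i l * k t l j].

Lemma sum_delta (R : realType) (V : finType) (i : V) (f : V -> R) :
  \sum_j (i == j)%:R * f j = f i.
Proof.
rewrite (bigD1 i)//= eqxx mul1r big1 ?addr0// => j ji.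
by rewrite eq_sym (negbTE ji) mul0r.
Qed.

Lemma is_derive_sum_fun (R : realType) (I : Type) (s : seq I)
    (f : I -> R -> R) (df : I -> R) (x : R) :
  (forall i, is_derive x (1 : R) (f i) (df i)) ->
  is_derive x (1 : R) (fun y => \sum_(i <- s) f i y) (\sum_(i <- s) df i).
Proof.
move=> fd; elim: s => [|i s ih].
  rewrite big_nil; under eq_fun do rewrite big_nil.
  exact: is_derive_cst.
rewrite big_cons; under eq_fun do rewrite big_cons.
exact: is_deriveD.
Qed.

Lemma continuous_sum_fun (R : realType) (I : Type) (s : seq I) (f : I -> R -> R) :
  (forall i, continuous (f i)) -> continuous (fun t => \sum_(i <- s) f i t).
Proof. by move=> cf; apply: continuous_big => [|i _ //]; exact: add_continuous. Qed.

Section matrix_exponential.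
Context (R : realType) (V : finType) (M : V -> V -> R) (k : R -> V -> V -> R)
  (kM : is_matrix_exp M k).

Lemma matrix_exp_derive_rev (t s : R) i j :
  is_derive s (1 : R) (fun s => k (t - s) i j) (- \sum_l k (t - s) i l * M l j).
Proof.
have [_ dk _] := kM.
have d1 : is_derive s (1 : R) (fun s => t - s) (0 - 1).
  exact: (is_deriveB (is_derive_cst t s (1 : R)) (is_derive_id s (1 : R))).
apply: (is_derive_eq (@is_derive1_comp _ (fun t => k t i j) (fun s => t - s) s _ _ (dk _ i j) d1)).
by rewrite sub0r mulrN1.
Qed.

(** The left-hand side has derivative [- k (t - s) M k s + k (t - s) M k s = 0] in
    [s], and equals [k t] at [s = 0]. *)
Lemma matrix_exp_subK (t s : R) i j : \sum_l k (t - s) i l * k s l j = k t i j.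
Proof.
have [k0 dk comm] := kM.
pose F s := \sum_l k (t - s) i l * k s l j.
have -> : k t i j = F 0.
  rewrite /F subr0 (bigD1 j)//= k0 eqxx mulr1 big1 ?addr0// => l lj.
  by rewrite k0 (negbTE lj) mulr0.
apply: (@is_derive_0_is_cst _ F) => {}s.
apply: (is_derive_eq (is_derive_sum_fun _ (fun l =>
  is_deriveM (matrix_exp_derive_rev t s i l) (dk s l j)))).
rewrite big_split /GRing.scale /=.
under eq_bigr do rewrite comm mulr_sumr.
under [X in _ + X]eq_bigr do rewrite mulrN mulr_sumr.
rewrite exchange_big /= sumrN -sumrB big1// => l _.
rewrite -sumrB big1// => m _; ring.
Qed.

Lemma matrix_exp_continuous i j : continuous (fun t => k t i j).
Proof.
have [_ dk _] := kM => t.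
by apply/differentiable_continuous/derivable1_diffP; case: (dk t i j).
Qed.

Lemma matrix_exp_primitive c d i j :
  primitive c d (fun t => k t i j) (fun t => \sum_l M i l * k t l j).
Proof.
have [_ dk comm] := kM; apply: primitive_C1 => [t|]; first by rewrite -comm.
apply: continuous_sum_fun => l t.
by apply: continuousM; [exact: cst_continuous|exact: matrix_exp_continuous].
Qed.

Lemma matrix_exp_primitive_rev c d t i j :
  primitive c d (fun s => k (t - s) i j) (fun s => - \sum_l k (t - s) i l * M l j).
Proof.
apply: primitive_C1 => [s|]; first exact: matrix_exp_derive_rev.
have ck i' j' : continuous (fun s => k (t - s) i' j').
  move=> s; apply/differentiable_continuous/derivable1_diffP.
  by case: (matrix_exp_derive_rev t s i' j').
move=> s; apply: continuousN; move: s; apply: continuous_sum_fun => l s.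
by apply: continuousM; [exact: ck|exact: cst_continuous].
Qed.

(** For fixed [t] the function [k (t - s) w(s)] of [s] has derivative
    [- k (t - s) M w(s) + k (t - s) (M w(s) + b(s)) = k (t - s) b(s)]. Compare its
    values at [0] and [t]. *)
Lemma duhamel (c d t : R) (w b : R -> V -> R) (i : V) :
  c <= 0 <= d -> c <= t <= d ->
  (forall j, primitive c d (fun s => w s j)
    (fun s => \sum_l M j l * w s l + b s j)) ->
  w t i = \sum_j k t i j * w 0 j +
    ointegralV 0 t (fun s j => \sum_l k (t - s) j l * b s l) i.
Proof.
move=> cd ctd hw; have [k0 _ _] := kM.
pose F s := \sum_j k (t - s) i j * w s j.
have pF : primitive c d F (fun s => \sum_l k (t - s) i l * b s l).
  have := primitive_sum (index_enum V) (fun j =>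
     primitiveM (matrix_exp_primitive_rev c d t i j) (hw j)).
  apply: eq_primitive => // s _; rewrite big_split /=.
  under [X in _ + X = _]eq_bigr do rewrite mulrDr mulr_sumr.
  rewrite big_split /= addrA.
  under eq_bigr do rewrite mulNr mulr_suml.
  rewrite sumrN exchange_big /= -sumrN -big_split /= big1 ?add0r// => l _.
  by rewrite addrC -sumrB big1// => m _; ring.
rewrite (ointegral_primitive cd ctd pF) /F subrr subr0.
under [X in _ + (X - _)]eq_bigr do rewrite k0.
by rewrite sum_delta addrC subrK.
Qed.

(** By the group law [w t = k t (w0 + \int_0^t k (-s) b(s) ds)], a product to which
    the Leibniz rule applies. Integrands depending on [t] are thereby avoided. *)
Lemma duhamel_conv (c d : R) (w0 : V -> R) (w b : R -> V -> R) :
  c <= 0 <= d ->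
  (forall j, Linfty `[c, d] (fun s => b s j)) ->
  (forall t, c <= t <= d -> forall i, w t i = \sum_j k t i j * w0 j +
    ointegralV 0 t (fun s j => \sum_l k (t - s) j l * b s l) i) ->
  forall j, primitive c d (fun s => w s j)
    (fun s => \sum_l M j l * w s l + b s j).
Proof.
move=> cd Lb hw j; have [k0 _ _] := kM.
pose f s l := \sum_m k (0 - s) l m * b s m.
have Lf l : Linfty `[c, d] (f^~ l).
  apply: Linfty_sum => m.
  exact: (LinftyM (primitive_Linfty (matrix_exp_primitive_rev c d 0 l m)) (Lb m)).
pose y s l := w0 l + (\int[mu R]_(x in `[c, s]) f x l -
  \int[mu R]_(x in `[c, 0]) f x l).
have py l : primitive c d (y^~ l) (f^~ l).
  have := primitiveD (primitive_cst c d (w0 l - \int[mu R]_(x in `[c, 0]) f x l))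
    (primitive_integral (Lf l)).
  apply: eq_primitive => s _; last by rewrite add0r.
  by rewrite /y addrCA addrC.
have y0 l : y 0 l = w0 l by rewrite /y subrr addr0.
have wE t i : c <= t <= d -> w t i = \sum_l k t i l * y t l.
  move=> tcd; rewrite hw//.
  have : primitive c d (fun s => \sum_l k t i l * y s l)
      (fun s => \sum_m k (t - s) i m * b s m).
    have := primitive_sum (index_enum V) (fun l => primitiveZ (k t i l) (py l)).
    apply: eq_primitive => // s _; rewrite /f.
    under eq_bigr do rewrite mulr_sumr.
    rewrite exchange_big /=; apply: eq_bigr => m _.
    have := matrix_exp_subK (t - s) (0 - s) i m; rewrite opprB addrA subrK subr0 => <-.
    by rewrite mulr_suml; apply: eq_bigr => l _; rewrite mulrA.
  move=> /(@ointegral_primitive R V c d _ (fun s j => \sum_l k (t - s) j l * b s l) i t cd tcd) ->.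
  by under [X in _ + (_ - X)]eq_bigr do rewrite y0; rewrite addrC subrK.
have := primitive_sum (index_enum V) (fun l =>
  primitiveM (matrix_exp_primitive c d j l) (py l)).
apply: eq_primitive => s scd; first by rewrite wE.
rewrite big_split /=; congr (_ + _).
  under eq_bigr do rewrite mulr_suml.
  rewrite exchange_big /=; apply: eq_bigr => l _.
  by rewrite wE// mulr_sumr; apply: eq_bigr => m _; rewrite mulrA.
rewrite /f; under eq_bigr do rewrite mulr_sumr.
rewrite exchange_big /= -[RHS](sum_delta j (b s)); apply: eq_bigr => m _.
have := matrix_exp_subK 0 (0 - s) j m.
rewrite (_ : 0 - (0 - s) = s) ?k0; last by ring.
move=> <-.
by rewrite mulr_suml; apply: eq_bigr => l _; rewrite mulrA.
Qed.

End matrix_exponential.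

(** * The heat kernel of the graph *)

Section heat_flow.
Context (R : realType) (V : finType) (G : wgraph R V) (r : R).
Local Notation L := (laplacian G r).

Definition delta (j i : V) : R := (i == j)%:R.

Definition lap_mx (i j : V) : R := L (delta j) i.

Lemma laplacianE (u : V -> R) i : L u i = \sum_j lap_mx i j * u j.
Proof.
rewrite /lap_mx /laplacian.
under [RHS]eq_bigr do rewrite -mulrA.
rewrite -mulr_sumr; congr (_ * _).
under [RHS]eq_bigr do rewrite mulr_suml.
rewrite exchange_big /=; apply: eq_bigr => k _.
under eq_bigr do rewrite -mulrA.
rewrite -mulr_sumr; congr (_ * _).
under eq_bigr do rewrite mulrBl.
by rewrite sumrB !sum_delta.
Qed.

Lemma iter_laplacian_bound (u : V -> R) : exists2 B, 0 <= B & exists2 K, 0 <= K &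
  forall n i, `|iter n L u i| <= B * K ^+ n.
Proof.
(* [K], the sum of all entries, bounds the operator norm of the Laplacian for the
   maximum norm. *)
exists (\sum_j `|u j|); first exact: sumr_ge0.
exists (\sum_i \sum_j `|lap_mx i j|).
  by apply: sumr_ge0 => i _; exact: sumr_ge0.
elim=> [|n ih] i.
  by rewrite expr0 mulr1 /= (bigD1 i)//= lerDl; exact: sumr_ge0.
rewrite iterS laplacianE exprS mulrCA.
apply: (le_trans (ler_norm_sum _ _ _)).
apply: (@le_trans _ _ (\sum_j `|lap_mx i j| * (\sum_j `|u j| * (\sum_i \sum_j `|lap_mx i j|) ^+ n))).
  by apply: ler_sum => j _; rewrite normrM ler_wpM2l// -mulr_suml; exact: ih.
rewrite -mulr_suml -mulr_suml ler_wpM2r//.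
  by rewrite mulr_ge0 ?exprn_ge0// sumr_ge0// => k _; exact: sumr_ge0.
rewrite [leRHS](bigD1 i)//= lerDl sumr_ge0// => k _.
exact: sumr_ge0.
Qed.

Definition heat_coef (u : V -> R) (i : V) (n : nat) : R :=
  (-1) ^+ n / n`!%:R * iter n L u i.

Lemma heatE t u i : heat G r t u i = limn (pseries (heat_coef u i) t).
Proof.
rewrite /heat /pseries; congr (limn (series _)).
apply/funext => n; rewrite /heat_coef.
by rewrite [RHS]mulrAC; congr (_ * _); rewrite mulrAC.
Qed.

Lemma cvg_pseries_heat u i x : cvgn (pseries (heat_coef u i) x).
Proof.
have [B B0 [K K0 hB]] := iter_laplacian_bound u.
apply: normed_cvg.
apply: (@series_le_cvg _ _ (fun n => B * exp_coeff (K * `|x|) n)).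
- by move=> n; exact: normr_ge0.
- by move=> n; rewrite mulr_ge0// /exp_coeff /= divr_ge0// exprn_ge0// mulr_ge0.
- move=> n; rewrite /= /heat_coef !normrM normrX normrN1 expr1n mul1r normfV normr_nat.
  rewrite normrX /exp_coeff /= exprMn.
  rewrite [leRHS](_ : _ = (n`!%:R)^-1 * (B * K ^+ n) * `|x| ^+ n); last by ring.
  by rewrite ler_wpM2r ?exprn_ge0// ler_wpM2l// invr_ge0.
- exact: (is_cvg_seriesZ (is_cvg_series_exp_coeff _)).
Qed.

Lemma heat_cvg t u i : pseries (heat_coef u i) t @ \oo --> heat G r t u i.
Proof. by rewrite heatE; exact: cvg_pseries_heat. Qed.

Lemma heat_coef_diffs u i :
  pseries_diffs (heat_coef u i) = - heat_coef (L u) i.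
Proof.
apply/funext => n; rewrite /pseries_diffs fctE /heat_coef iterSr factS natrM invfM exprS.
have n0 : n.+1%:R != 0 :> R by rewrite pnatr_eq0.
have f0 : n`!%:R != 0 :> R by rewrite pnatr_eq0 -lt0n fact_gt0.
by move: n.+1%:R n0 => N N0; field; rewrite N0 f0.
Qed.

Lemma pseriesN (c : nat -> R) x : pseries (- c) x = - pseries c x.
Proof.
apply/funext => n; transitivity (- \sum_(0 <= i < n) c i * x ^+ i); last by [].
by rewrite -sumrN; apply: eq_bigr => i _; rewrite -mulNr.
Qed.

Lemma heat_derive t u i :
  is_derive t (1 : R) (fun t => heat G r t u i) (- heat G r t (L u) i).
Proof.
have -> : (fun t => heat G r t u i) = (fun t => limn (pseries (heat_coef u i) t)).
  by apply/funext => s; exact: heatE.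
apply: (is_derive_eq (@pseries_snd_diffs _ _ (`|t| + 1) t _ _ _ _)).
- exact: cvg_pseries_heat.
- by rewrite heat_coef_diffs pseriesN; apply: is_cvgN; exact: cvg_pseries_heat.
- rewrite heat_coef_diffs (_ : pseries_diffs _ = heat_coef (L (L u)) i).
    exact: cvg_pseries_heat.
  by rewrite pseries_diffsN heat_coef_diffs opprK.
- by rewrite [ltRHS]ger0_norm ?addr_ge0// ltrDl.
by rewrite heat_coef_diffs pseriesN limN ?heatE//; exact: cvg_pseries_heat.
Qed.

(** Termwise linearity of the exponential series passes to its sum. The vectors and
    nodes on the right may vary with the summation index, so as to cover both the
    expansion of [u] in unit vectors and the application of the Laplacian to the
    sum. *)
Lemma heat_linear (J : finType) t u i (a : J -> R) (v : J -> V -> R) (m : J -> V) :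
  (forall n, iter n L u i = \sum_j a j * iter n L (v j) (m j)) ->
  heat G r t u i = \sum_j a j * heat G r t (v j) (m j).
Proof.
move=> uE; rewrite heatE; apply: cvg_lim => //.
rewrite (_ : pseries _ t = fun n => \sum_j a j * pseries (heat_coef (v j) (m j)) t n).
  apply: cvg_big => [|j _]; first exact: add_continuous.
  apply: cvgM; [exact: cvg_cst|exact: heat_cvg].
apply/funext => n; rewrite /pseries /series /=.
under [RHS]eq_bigr do rewrite mulr_sumr.
rewrite exchange_big /=; apply: eq_bigr => l _.
rewrite /heat_coef uE mulr_sumr mulr_suml; apply: eq_bigr => j _.
by ring.
Qed.

Lemma iter_laplacian_linear n (u : V -> R) i :
  iter n L u i = \sum_j u j * iter n L (delta j) i.
Proof.
elim: n i => [|n ih] i.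
  rewrite /= -[LHS](sum_delta i); apply: eq_bigr => j _.
  by rewrite /delta mulrC.
rewrite iterS laplacianE.
under eq_bigr do rewrite ih mulr_sumr.
rewrite exchange_big /=; apply: eq_bigr => j _.
by rewrite laplacianE mulr_sumr; apply: eq_bigr => l _; rewrite mulrCA.
Qed.

Lemma heat_kernelE t u i : heat G r t u i = \sum_j heat G r t (delta j) i * u j.
Proof.
rewrite (@heat_linear V t u i u delta (fun=> i)).
  by apply: eq_bigr => j _; rewrite mulrC.
by move=> n; exact: iter_laplacian_linear.
Qed.

Lemma heat_laplacian t u i : heat G r t (L u) i = L (heat G r t u) i.
Proof.
rewrite laplacianE; apply: (@heat_linear V t (L u) i _ (fun=> u) id) => n.
by rewrite -iterSr iterS laplacianE.
Qed.

Lemma heat0 u i : heat G r 0 u i = u i.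
Proof.
rewrite heatE; apply: lim_near_cst => //; near=> n.
have n0 : (0 < n)%N by near: n; exact: nbhs_infty_gt.
rewrite /pseries /series /= big_ltn// big_nat_cond big1 ?addr0.
  by rewrite /heat_coef !expr0 fact0 /= !mulr1 divr1 mul1r.
by move=> l /andP[/andP[l0 _] _]; rewrite expr0n gtn_eqF//= mulr0.
Unshelve. all: by end_near. Qed.

Context (eps : R).

(** The matrix of [exp (t M)] for [M = 1 / eps - Delta], which is [flow_mx]. *)
Definition flow_kernel (t : R) (i j : V) : R :=
  expR (t / eps) * heat G r t (delta j) i.

Definition flow_mx (i j : V) : R := eps^-1 * (i == j)%:R - lap_mx i j.

Lemma flow_mxE (u : V -> R) i :
  \sum_j flow_mx i j * u j = eps^-1 * u i - L u i.
Proof.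
rewrite laplacianE -[u i](sum_delta i) mulr_sumr -sumrB.
by apply: eq_bigr => j _; rewrite /flow_mx; ring.
Qed.

Lemma flow_kernelE t (u : V -> R) i :
  expR (t / eps) * heat G r t u i = \sum_j flow_kernel t i j * u j.
Proof.
by rewrite heat_kernelE mulr_sumr; apply: eq_bigr => j _; rewrite mulrA.
Qed.

Lemma flow_kernel_matrix_exp : is_matrix_exp flow_mx flow_kernel.
Proof.
have fkM t i j : \sum_l flow_kernel t i l * flow_mx l j =
    eps^-1 * flow_kernel t i j - expR (t / eps) * heat G r t (L (delta j)) i.
  rewrite heat_kernelE mulr_sumr -[flow_kernel t i j](sum_delta j) mulr_sumr -sumrB.
  by apply: eq_bigr => l _; rewrite /flow_mx /flow_kernel /lap_mx (eq_sym l); ring.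
split=> [i j|t i j|t i j].
- by rewrite /flow_kernel mul0r expR0 mul1r heat0.
- rewrite fkM.
  have de : is_derive t (1 : R) (fun t => expR (t / eps)) (expR (t / eps) * eps^-1).
    apply: (@is_derive1_comp _ expR (fun t => t / eps)).
    have := is_derive_affine eps^-1 0 t.
    by under eq_fun do rewrite addr0 mulrC.
  apply: (is_derive_eq (is_deriveM de (heat_derive t (delta j) i))).
  by rewrite /GRing.scale /= /flow_kernel; ring.
- by rewrite fkM flow_mxE /flow_kernel heat_laplacian !laplacianE mulr_sumr;
    congr (_ - _); apply: eq_bigr => l _; ring.
Qed.

End heat_flow.

(** * Almost everywhere on an interval *)

(** Points of [T] that are neither its minimum nor its maximum lie in an interval
    with rational end points in [T]. So countably many of the bounded open
    intervals on which solutions are defined cover [T] up to a null set. *)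
Lemma interval_cover (R : realType) (T : set R) : is_interval T ->
  exists2 N, (mu R).-negligible N &
  forall t, T t -> N t \/
    exists p q : rat, [/\ T (ratr p), T (ratr q) & ratr p < t < ratr q].
Proof.
move=> iT.
pose Nl := [set t | T t /\ forall x, T x -> t <= x].
pose Nr := [set t | T t /\ forall x, T x -> x <= t].
have neg1 (A : set R) : (forall x y, A x -> A y -> x = y) ->
    (mu R).-negligible A.
  move=> A1; case: (pselect (exists x, A x)) => [[x Ax]|A0].
    exists [set x]; split; last by move=> y Ay; exact: A1.
    - by rewrite -set_itv1; exact: measurable_itvL.
    - exact: mu_set1.
  by exists set0; split=> // x Ax; apply: A0; exists x.
exists (Nl `|` Nr).
  apply: negligibleU; apply: neg1 => x y [Tx hx] [Ty hy]; apply/eqP; rewrite eq_le.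
    by rewrite hx// hy.
  by rewrite hx// hy.
move=> t Tt; case: (pselect (Nl t)) => [|nl]; first by left; left.
case: (pselect (Nr t)) => [|nr]; first by left; right.
right.
have [x Tx xt] : exists2 x, T x & x < t.
  apply: contrapT => h; apply: nl; split=> // x Tx; rewrite leNgt; apply/negP => xt.
  by apply: h; exists x.
have [y Ty ty] : exists2 y, T y & t < y.
  apply: contrapT => h; apply: nr; split=> // y Ty; rewrite leNgt; apply/negP => ty.
  by apply: h; exists y.
have [p] := rat_in_itvoo xt; rewrite in_itv/= => /andP[xp pt].
have [q] := rat_in_itvoo ty; rewrite in_itv/= => /andP[tq qy].
exists p, q; split; last by rewrite pt tq.
- by apply: (iT x t) => //; rewrite (ltW xp) (ltW pt).
- by apply: (iT t y) => //; rewrite (ltW tq) (ltW qy).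
Qed.

Lemma ae_interval (R : realType) (T : set R) (P : R -> Prop) : is_interval T ->
  (forall a b, T a -> T b -> a < b ->
    {ae mu R, forall t, a < t < b -> P t}) ->
  {ae mu R, forall t, T t -> P t}.
Proof.
move=> iT hP; have [N negN cov] := interval_cover iT.
have aeN : {ae mu R, forall t, ~ N t}.
  by apply: negligibleS negN => t /= /contrapT.
have aeP : {ae mu R, forall t, forall p q : rat,
    T (ratr p) -> T (ratr q) -> ratr p < t < ratr q -> P t}.
  apply: ae_rat => p; apply: ae_rat => q.
  have [Tp|nTp] := pselect (T (ratr p)); last by apply: aeW => t /nTp.
  have [Tq|nTq] := pselect (T (ratr q)); last by apply: aeW => t _ /nTq.
  have [pq|qp] := ltP (ratr p : R) (ratr q); last first.
    by apply: aeW => t _ _ /andP[/lt_trans] /[apply]; rewrite ltNge qp.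
  by apply: (ae_imply (hP _ _ Tp Tq pq)) => t h _ _.
apply: (ae_imply2 aeN aeP) => t nN h /cov[//|[p [q [Tp Tq pq]]]].
exact: h pq.
Qed.

Lemma measurable_interval (R : realType) (T A : set R) (f : R -> R) :
  is_interval T -> A `<=` T -> @measurable _ (lebesgueR R) A ->
  (forall a b, T a -> T b -> a < b ->
    @measurable_fun _ _ (lebesgueR R) R `]a, b[ f) ->
  @measurable_fun _ _ (lebesgueR R) R A f.
Proof.
move=> iT AT mA hf _ B mB; have [N negN cov] := interval_cover iT.
pose F (p q : rat) : set R := if `[< T (ratr p) /\ T (ratr q) /\ ratr p < ratr q :> R >]
  then A `&` (`]ratr p, ratr q[ `&` f @^-1` B) else set0.
have -> : A `&` f @^-1` B = \bigcup_p \bigcup_q F p q `|` (A `&` f @^-1` B `&` N).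
  apply/seteqP; split => t /=.
    move=> [At Bt]; have [|[p [q [Tp Tq /andP[pt tq]]]]] := cov t (AT t At).
      by right.
    left; exists p => //; exists q => //; rewrite /F.
    case: asboolP => [_|[]]; last by do !split => //; exact: lt_trans tq.
    by split => //; split => //=; rewrite in_itv/= pt.
  case=> [[p _ [q _]]|[]//]; rewrite /F; case: asboolP => // _ [At [_ Bt]].
  by split.
apply: measurableU.
  apply: bigcupT_measurable_rat => p; apply: bigcupT_measurable_rat => q.
  rewrite /F; case: asboolP => [[Tp [Tq pq]]|_]; last exact: measurable0.
  apply: measurableI => //; apply: (hf _ _ Tp Tq pq) => //.
  exact: measurable_itvL.
apply: (@completed_lebesgue_measure_is_complete R).
by apply: negligibleS negN => t [].
Qed.

(** * The weighted norm *)

Section weighted_norm.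
Context (R : realType) (V : finType) (G : wgraph R V) (r : R).

Lemma nodeweight_gt0 i : 0 < degree G i `^ r.
Proof. by apply: powR_gt0; exact: degree_gt0. Qed.

Lemma innerV_ge0 u : 0 <= innerV G r u u.
Proof.
by apply: sumr_ge0 => i _; rewrite mulr_ge0 ?powR_ge0// -expr2 sqr_ge0.
Qed.

Lemma normV_sqr u : normV G r u ^+ 2 = innerV G r u u.
Proof. by rewrite sqr_sqrtr// innerV_ge0. Qed.

Lemma normV_ge u i : `|u i| <= normV G r u / Num.sqrt (degree G i `^ r).
Proof.
rewrite ler_pdivlMr ?sqrtr_gt0 ?nodeweight_gt0// -sqrtr_sqr -sqrtrM ?sqr_ge0//.
rewrite ler_wsqrtr// /innerV [leRHS](bigD1 i)//= expr2 lerDl.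
by apply: sumr_ge0 => j _; rewrite mulr_ge0 ?powR_ge0// -expr2 sqr_ge0.
Qed.

Lemma normV_le u M : 0 <= M -> (forall i, `|u i| <= M) ->
  normV G r u <= M * Num.sqrt (\sum_i degree G i `^ r).
Proof.
move=> M0 uM; rewrite -[M]ger0_norm// -sqrtr_sqr -sqrtrM ?sqr_ge0//.
rewrite ler_wsqrtr// mulr_sumr; apply: ler_sum => i _.
rewrite ler_wpM2r ?powR_ge0// -expr2 -[leLHS]real_normK ?num_real//.
by rewrite lerXn2r ?nnegrE// (le_trans _ (uM i)).
Qed.

(** [|x| <= 1 + x^2], and constants are integrable on a bounded interval. *)
Lemma L2_integrable (a b : R) (f : R -> V -> R) i :
  L2 G r `]a, b[ f ->
  (mu R).-integrable `]a, b[ (EFin \o (fun t => f t i)).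
Proof.
move=> [mf foo]; have mi := @measurable_itvL R `]a, b[.
set c := degree G i `^ r.
have c0 : 0 < c := nodeweight_gt0 i.
have loo : (mu R `]a, b[ < +oo)%E.
  exact: (mu_bounded_lty mi (@subset_itv_oo_cc _ _ a b)).
have minner : @measurable_fun _ _ (lebesgueR R) R `]a, b[ (fun t => normV G r (f t) ^+ 2).
  rewrite (_ : (fun t => _) = (fun t => \sum_j f t j * f t j * degree G j `^ r)).
    apply: measurable_sum => j; apply: measurable_funM; last exact: measurable_cst.
    by apply: measurable_funM; exact: mf.
  by apply/funext => t; rewrite normV_sqr.
have iN : (mu R).-integrable `]a, b[
    (EFin \o (fun t => normV G r (f t) ^+ 2)).
  apply/integrableP; split; first exact/measurable_EFinP.
  under eq_integral do rewrite gee0_abs ?lee_fin ?sqr_ge0//.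
  exact: foo.
have i1 : (mu R).-integrable `]a, b[
    (EFin \o (fun t => 1 + c^-1 * normV G r (f t) ^+ 2)).
  apply: (@integrableD _ _ _ _ _ mi (EFin \o cst 1) (fun t => (c^-1 * normV G r (f t) ^+ 2)%:E)).
    exact: (Linfty_integrable_fin mi loo (Linfty_cst _ 1)).
  exact: (integrableZl mi c^-1 iN).
apply: le_integrable i1 => //.
  by apply/measurable_EFinP; exact: mf.
move=> t _; rewrite lee_fin.
have h : f t i ^+ 2 <= c^-1 * normV G r (f t) ^+ 2.
  rewrite ler_pdivlMl// mulrC normV_sqr /innerV (bigD1 i)//= expr2 lerDl.
  by apply: sumr_ge0 => j _; rewrite mulr_ge0 ?powR_ge0// -expr2 sqr_ge0.
rewrite [leRHS]ger0_norm; last by rewrite addr_ge0// (le_trans _ h) ?sqr_ge0.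
apply: le_trans (_ : 1 + f t i ^+ 2 <= _); last by rewrite lerD2l.
rewrite -real_normK ?num_real//.
have := sqr_ge0 (`|f t i| - 1); have := normr_ge0 (f t i).
by move: `|f t i| => x; nra.
Qed.

Lemma Linfty_L2 (a b : R) (f : R -> V -> R) :
  (forall i, Linfty `[a, b] (fun t => f t i)) -> L2 G r `]a, b[ f.
Proof.
move=> Lf.
have sub : `]a, b[%classic `<=` `[a, b]%classic by exact: subset_itv_oo_cc.
have Lf' i : Linfty `]a, b[ (fun t => f t i).
  exact: (Linfty_sub (measurable_itvL _) sub (Lf i)).
split; first by move=> i; case: (Lf' i).
have L : Linfty `[a, b] (fun t => normV G r (f t) ^+ 2).
  rewrite (_ : (fun t => _) = (fun t => \sum_j f t j * f t j * degree G j `^ r)).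
    apply: Linfty_sum => j; apply: LinftyM; last exact: Linfty_cst.
    exact: LinftyM.
  by apply/funext => t; rewrite normV_sqr.
apply: (integrable_lty (measurable_itvL _)).
exact: (integrableS (measurable_itvL _) (measurable_itvL _) sub (Linfty_integrable L)).
Qed.

Lemma continuousV_within (T : set R) (u : R -> V -> R) a b i :
  Defs.continuousV G r T u -> `[a, b]%classic `<=` T ->
  {within `[a, b], continuous (fun t => u t i)}.
Proof.
move=> cu abT; apply/subspace_continuousP => x abx.
apply/cvgrPdist_lt => e e0.
have c0 := nodeweight_gt0 i.
have e1 : 0 < e * Num.sqrt (degree G i `^ r) by rewrite mulr_gt0 ?sqrtr_gt0.
have /cvgrPdist_lt/(_ _ e1) := cu x (abT _ abx).
move=> H; have : \forall s \near within `[a, b] (nbhs x),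
    `|0 - normV G r (u s - u x)| < e * Num.sqrt (degree G i `^ r).
  apply: (filterS _ (H : nbhs x (fun s => T s ->
    `|0 - normV G r (u s - u x)| < e * Num.sqrt (degree G i `^ r)))).
  by move=> s h /abT; exact: h.
apply: filterS => s; rewrite sub0r normrN (ger0_norm (sqrtr_ge0 _)) => h.
rewrite distrC; apply: le_lt_trans (normV_ge (u s - u x) i) _.
by rewrite ltr_pdivrMr ?sqrtr_gt0.
Qed.

(** Around any point of [T] the set [T] coincides with a compact interval with end
    points in [T]; at an end point of [T] one end of that interval is the point
    itself. *)
Lemma lipschitz_continuousV (T : set R) (u : R -> V -> R) :
  is_interval T ->
  (forall a b, T a -> T b -> a <= b -> forall i, exists2 M, 0 <= M &
    forall s t, a <= s <= b -> a <= t <= b -> `|u t i - u s i| <= M * `|t - s|) ->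
  Defs.continuousV G r T u.
Proof.
move=> iT lip t Tt.
have [a [Ta at_ hl]] : exists a, [/\ T a, a <= t &
    \forall s \near t, T s -> a <= s].
  have [[x [Tx xt]]|h] := pselect (exists x, T x /\ x < t).
    exists x; split=> //; first exact: ltW.
    by near=> s => _; apply: ltW; near: s; exact: lt_nbhsr.
  exists t; split=> //; near=> s => Ts; rewrite leNgt; apply/negP => st.
  by apply: h; exists s.
have [b [Tb tb hr]] : exists b, [/\ T b, t <= b &
    \forall s \near t, T s -> s <= b].
  have [[x [Tx xt]]|h] := pselect (exists x, T x /\ t < x).
    exists x; split=> //; first exact: ltW.
    by near=> s => _; apply: ltW; near: s; exact: lt_nbhsl.
  exists t; split=> //; near=> s => Ts; rewrite leNgt; apply/negP => st.
  by apply: h; exists s.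
have ab := le_trans at_ tb.
have /choice[M hM] : forall i, exists M, 0 <= M /\
    forall s t, a <= s <= b -> a <= t <= b -> `|u t i - u s i| <= M * `|t - s|.
  by move=> i; have [M M0 hM] := lip a b Ta Tb ab i; exists M.
pose K := (\sum_i M i) * Num.sqrt (\sum_i degree G i `^ r).
have SM0 : 0 <= \sum_i M i by apply: sumr_ge0 => i _; case: (hM i).
have K0 : 0 <= K by rewrite mulr_ge0// sqrtr_ge0.
apply/cvgrPdist_lt => e e0; near=> s.
have Ts : T s by near: s; exact: withinT.
have sab : a <= s <= b.
  apply/andP; split; move: (Ts); near: s; apply: cvg_within; [exact: hl|exact: hr].
rewrite sub0r normrN (ger0_norm (sqrtr_ge0 _)).
apply: (@le_lt_trans _ _ ((K + 1) * `|t - s|)); last first.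
  rewrite -ltr_pdivlMl ?ltr_wpDl//; near: s; apply: cvg_within.
  by apply/nbhs_ballP; exists ((K + 1)^-1 * e) => //=; rewrite mulr_gt0// invr_gt0 ltr_wpDl.
apply: (@le_trans _ _ (K * `|t - s|)); last by rewrite ler_wpM2r// lerDl.
rewrite /K mulrAC; apply: normV_le => [|i]; first by rewrite mulr_ge0.
have [Mi0 lipi] := hM i.
rewrite distrC; apply: (le_trans (lipi _ _ sab _)); first by rewrite at_ tb.
rewrite ler_wpM2r// (bigD1 i)//= lerDl.
by apply: sumr_ge0 => j _; case: (hM j).
Unshelve. all: by end_near. Qed.

End weighted_norm.

(** * The forcing term of the integral formula *)

Section forcing_term.
Context (R : realType) (V : finType) (G : wgraph R V) (r eps : R).
Local Notation L := (laplacian G r).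
Local Notation flow_mx := (flow_mx G r eps).
Local Notation flow_kernel := (flow_kernel G r eps).

Lemma laplacian_shift (u : V -> R) (c : R) i :
  L (u - cst c) i = L u i.
Proof.
rewrite /laplacian; congr (_ * _); apply: eq_bigr => j _.
by rewrite !fctE /cst; congr (_ * _); ring.
Qed.

Lemma flow_mx_shift (u : V -> R) i :
  \sum_j flow_mx i j * (u j - 2^-1) = eps^-1 * (u i - 2^-1) - L u i.
Proof. by rewrite (flow_mxE G r eps (u - cst 2^-1)) laplacian_shift. Qed.

Lemma ointegralVZ (g : R -> V -> R) (c d t e : R) i :
  c <= 0 <= d -> c <= t <= d -> Linfty `[c, d] (fun s => g s i) ->
  ointegralV 0 t (fun s j => e * g s j) i = e * ointegralV 0 t g i.
Proof.
move=> /andP[c0 d0] /andP[ct td] Lg; rewrite /ointegralV /integralV.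
case: ifPn => _.
  rewrite RintegralZl//; first exact: measurable_itvL.
  exact: Linfty_integrable_sub Lg.
transitivity (- \int[mu R]_(s in `[t, 0]) (e * g s i)) => //.
rewrite RintegralZl; last 2 first.
- exact: measurable_itvL.
- exact: Linfty_integrable_sub Lg.
by rewrite -mulrN.
Qed.

Lemma duhamel_term (c d t : R) (beta : R -> V -> R) i :
  c <= 0 <= d -> c <= t <= d -> (forall j, Linfty `[c, d] (fun s => beta s j)) ->
  ointegralV 0 t (fun s j => \sum_l flow_kernel (t - s) j l * (eps^-1 * beta s l)) i =
  (eps^-1 *: ointegralV 0 t (fun s =>
     expR ((t - s) / eps) *: heat G r (t - s) (beta s))) i.
Proof.
move=> cd ctd Lb.
have sg := flow_kernel_matrix_exp G r eps.
transitivity (ointegralV 0 t (fun s j => eps^-1 * \sum_l flow_kernel (t - s) j l * beta s l) i).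
  congr (ointegralV 0 t _ i); apply/funext => s; apply/funext => j.
  by rewrite mulr_sumr; apply: eq_bigr => l _; rewrite mulrCA.
rewrite (ointegralVZ (g := fun s j => \sum_l flow_kernel (t - s) j l * beta s l) _ cd ctd).
  transitivity (eps^-1 * ointegralV 0 t (fun s =>
     expR ((t - s) / eps) *: heat G r (t - s) (beta s)) i) => //.
  congr (_ * ointegralV 0 t _ i); apply/funext => s; apply/funext => j.
  by rewrite -flow_kernelE.
apply: Linfty_sum => l.
exact: (LinftyM (primitive_Linfty (matrix_exp_primitive_rev sg c d t i l)) (Lb l)).
Qed.

Lemma interval_around0 (T : set R) t : T 0 -> T t -> exists c d,
  [/\ T c, T d, c <= 0 <= d & c <= t <= d].
Proof.
move=> T0 Tt; case: (leP 0 t) => [t0|/ltW t0].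
  by exists 0, t; rewrite !lexx t0.
by exists t, 0; rewrite !lexx t0.
Qed.

Lemma Linfty_laplacian (D : set R) (u : R -> V -> R) i :
  (forall j, Linfty D (fun t => u t j)) -> Linfty D (fun t => L (u t) i).
Proof.
move=> Lu; under eq_fun do rewrite laplacianE.
by apply: Linfty_sum => j; exact: LinftyZ.
Qed.

End forcing_term.

(** * Solutions satisfy the integral formula *)

Section necessity.
Context (R : realType) (V : finType) (G : wgraph R V) (r eps : R) (heps : 0 < eps).
Context (T : set R) (hT : is_interval T) (hT0 : T 0).
Context (u beta : R -> V -> R) (hu : forall t, T t -> V01 (u t)).
Local Notation L := (laplacian G r).
Context (cu : Defs.continuousV G r T u) (du : R -> V -> R).
Context (tdu : time_derivative G r T u du).
Context (eqB : {ae mu R, forall t, T t ->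
          eps *: du t + eps *: laplacian G r (u t) + cst 2^-1 - u t = beta t
          /\ Bset (u t) (beta t)}).

Lemma sub_interval a b : T a -> T b -> `[a, b]%classic `<=` T.
Proof. by move=> Ta Tb t; rewrite /= in_itv/= => abt; exact: hT abt. Qed.

Lemma AC_increment a b i : T a -> T b -> a <= b ->
  u b i - u a i = \int[mu R]_(t in `[a, b]) du t i.
Proof.
move=> Ta Tb; rewrite le_eqVlt => /predU1P[<-|ab].
  by rewrite subrr Rintegral_point.
have [L2du wdu] := tdu Ta Tb ab.
apply: (weak_derivative_increment (u := fun t => u t i) ab).
- exact: continuousV_within cu (sub_interval Ta Tb).
- exact: L2_integrable L2du.
by move=> phi /wdu/(congr1 (@^~ i)).
Qed.

Lemma AC_du_integrable a b i : T a -> T b -> a < b ->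
  (mu R).-integrable `[a, b] (EFin \o (fun t => du t i)).
Proof.
move=> Ta Tb ab; have [L2du _] := tdu Ta Tb ab.
exact/integrable_oo_cc/(L2_integrable i L2du).
Qed.

(** Both [u i] and [1 - u i] are nonnegative. *)
Lemma AC_du_obstacle : {ae mu R, forall t, T t ->
  forall i, (u t i = 0 -> du t i = 0) /\ (u t i = 1 -> du t i = 0)}.
Proof.
apply: ae_interval => // a b Ta Tb ab.
suff : {ae mu R, forall t, forall i, a < t < b ->
    (u t i = 0 -> du t i = 0) /\ (u t i = 1 -> du t i = 0)}.
  by move/ae_imply; apply => t h abt i; exact: h.
apply: ae_all => i.
have idu := AC_du_integrable i Ta Tb ab.
have Tab t : a <= t <= b -> T t by exact: hT.
have h0 := @derivative_zero_at_minimum R a b (fun t => u t i) (fun t => du t i) idu.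
have h1 := @derivative_zero_at_minimum R a b (fun t => 1 - u t i) (fun t => -1 * du t i).
have {}h0 := h0 _ _.
have z0 : {ae mu R, forall t, a < t < b -> u t i = 0 -> du t i = 0}.
  apply: h0.
    move=> t abt; have /andP[at_ _] := abt.
    by apply: AC_increment => //; exact: Tab.
  by move=> t /Tab/hu/(_ i)/andP[].
have z1 : {ae mu R, forall t, a < t < b -> 1 - u t i = 0 -> -1 * du t i = 0}.
  apply: h1.
  - by have := integrableZl (measurable_itvL _) (-1) idu.
  - move=> t abt; have /andP[at_ tb] := abt.
    rewrite RintegralZl; last 2 first.
    + exact: measurable_itvL.
    + apply: (integrableS (measurable_itvL _) (measurable_itvL _) _ idu).
      by apply: subset_itvl; rewrite bnd_simp.
    by rewrite -AC_increment//; [ring|exact: Tab].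
  - by move=> t /Tab/hu/(_ i)/andP[_]; rewrite subr_ge0.
apply: (ae_imply2 z0 z1) => t d0 d1 abt; split; first exact: d0.
by move=> u1; move: (d1 abt); rewrite u1 subrr mulN1r => /(_ erefl)/eqP; rewrite oppr_eq0 => /eqP.
Qed.

(** Where [0 < u i < 1] the multiplier [beta i] is [0]. Where [u i] touches an
    obstacle the time derivative is [0] almost everywhere, and the equation
    leaves [beta i = eps (Delta u) i + 1/2 - u i], which is bounded because [u]
    takes values in [[0, 1]]. The bound is uniform on all of [T]. *)
Lemma AC_beta_bound : exists2 B, 0 <= B &
  {ae mu R, forall t, T t -> forall i, `|beta t i| <= B}.
Proof.
pose S := \sum_i \sum_j `|lap_mx G r i j|.
have S0 : 0 <= S by apply: sumr_ge0 => i _; exact: sumr_ge0.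
exists (eps * S + 2^-1); first by rewrite addr_ge0// mulr_ge0// ltW.
apply: (ae_imply2 eqB AC_du_obstacle) => t hB hdu Tt i.
have [eB] := hB Tt; have u01 := hu Tt; move=> /(_ i)[_ Bint _].
have [d0 d1] := hdu Tt i.
have Lu : `|L (u t) i| <= S.
  rewrite laplacianE; apply: (le_trans (ler_norm_sum _ _ _)).
  apply: (@le_trans _ _ (\sum_j `|lap_mx G r i j|)).
    apply: ler_sum => j _; rewrite normrM ler_piMr//.
    by have /andP[? ?] := u01 j; rewrite ger0_norm.
  by rewrite /S [leRHS](bigD1 i)//= lerDl; apply: sumr_ge0 => k _; exact: sumr_ge0.
have obstacle : du t i = 0 -> `|beta t i| <= eps * S + 2^-1.
  move=> du0.
  have -> : beta t i = eps * du t i + eps * L (u t) i + 2^-1 - u t i by rewrite -eB.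
  rewrite du0 mulr0 add0r -addrA.
  apply: (le_trans (ler_normD _ _)); apply: lerD.
    by rewrite normrM gtr0_norm// ler_pM2l.
  by have /andP[? ?] := u01 i; rewrite ler_norml /cst; apply/andP; split; lra.
have /andP[] := u01 i; rewrite le_eqVlt => /predU1P[/esym/d0/obstacle//|u0].
rewrite le_eqVlt => /predU1P[/d1/obstacle//|u1].
by rewrite Bint ?u0// normr0 addr_ge0// mulr_ge0// ltW.
Qed.

Lemma AC_u_Linfty a b i : T a -> T b -> Linfty `[a, b] (fun t => u t i).
Proof.
by move=> Ta Tb; apply: continuous_Linfty; exact: continuousV_within cu (sub_interval Ta Tb).
Qed.

Lemma AC_du_eq : {ae mu R, forall t, T t -> forall i,
  beta t i = eps * du t i + eps * L (u t) i + 2^-1 - u t i}.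
Proof. by apply: (ae_imply eqB) => t h /h[<- _] i. Qed.

(** [beta] agrees almost everywhere with an expression that is measurable on every
    [`]a, b[] with [a], [b] in [T]. *)
Lemma AC_beta_measurable (A : set R) i :
  @measurable _ (lebesgueR R) A -> A `<=` T ->
  @measurable_fun _ _ (lebesgueR R) R A (fun t => beta t i).
Proof.
move=> mA AT; apply: (measurable_interval hT AT mA) => a b Ta Tb ab.
have sub : `]a, b[%classic `<=` `[a, b]%classic by exact: subset_itv_oo_cc.
have Lab j : Linfty `]a, b[ (fun t => u t j).
  exact: (Linfty_sub (measurable_itvL _) sub (AC_u_Linfty j Ta Tb)).
have [[mdu _] _] := tdu Ta Tb ab.
apply: (@ae_eq_measurable _ _ (fun t => eps * du t i + (eps * L (u t) i + 2^-1 + -1 * u t i))).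
  apply: (ae_imply AC_du_eq) => t h /sub/(sub_interval Ta Tb) Tt.
  by rewrite (h Tt i); ring.
apply: measurable_funD.
  by apply: measurable_funM; [exact: measurable_cst|exact: mdu].
have [] // : Linfty `]a, b[ (fun t => eps * L (u t) i + 2^-1 + -1 * u t i).
apply: LinftyD; last exact: LinftyZ.
by apply: LinftyD; [apply: LinftyZ; exact: Linfty_laplacian|exact: Linfty_cst].
Qed.

Lemma AC_beta_Linfty (A : set R) i :
  @measurable _ (lebesgueR R) A -> A `<=` T -> Linfty A (fun t => beta t i).
Proof.
move=> mA AT; split; first exact: AC_beta_measurable.
have [B _ hB] := AC_beta_bound.
by exists B; apply: (ae_imply hB) => t h /AT/h.
Qed.

(** The shift by [1/2] removes the constant term: since [Delta] annihilates
    constants, [w = u - 1/2] solves [w' = (1 / eps - Delta) w + beta / eps]. *)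
Lemma AC_primitive c d i : T c -> T d ->
  primitive c d (fun s => u s i - 2^-1)
    (fun s => \sum_l flow_mx G r eps i l * (u s l - 2^-1) + eps^-1 * beta s i).
Proof.
move=> Tc Td; have Tcd := sub_interval Tc Td.
have Lg : Linfty `[c, d] (fun s => \sum_l flow_mx G r eps i l * (u s l - 2^-1) + eps^-1 * beta s i).
  apply: LinftyD; last by apply: LinftyZ; apply: AC_beta_Linfty => //; exact: measurable_itvL.
  apply: Linfty_sum => l; apply: LinftyZ; apply: LinftyD; last exact: Linfty_cst.
  exact: AC_u_Linfty.
split=> // s t cs st td.
have Ts : T s by apply: Tcd; rewrite /= in_itv/= cs (le_trans st td).
have Tt : T t by apply: Tcd; rewrite /= in_itv/= td (le_trans cs st).
have -> : u t i - 2^-1 - (u s i - 2^-1) = u t i - u s i by ring.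
rewrite AC_increment//; apply/esym; apply: ae_eq_Rintegral.
- exact: measurable_itvL.
- apply: (ae_imply AC_du_eq) => x h /(sub_interval Ts Tt) Tx.
  rewrite flow_mx_shift (h Tx i); field.
  by rewrite gt_eqF.
- by case: (Linfty_subitv cs td Lg).
Qed.

Lemma AC_formula t : T t ->
  u t = cst 2^-1
        + expR (t / eps) *: heat G r t (u 0 - cst 2^-1)
        + eps^-1 *: ointegralV 0 t (fun s =>
            expR ((t - s) / eps) *: heat G r (t - s) (beta s)).
Proof.
move=> Tt; apply/funext => i.
have [c [d [Tc Td cd ctd]]] := interval_around0 hT0 Tt.
have Lb j : Linfty `[c, d] (fun s => beta s j).
  by apply: AC_beta_Linfty; [exact: measurable_itvL|exact: sub_interval].
have := duhamel (flow_kernel_matrix_exp G r eps) (w := fun s j => u s j - 2^-1)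
  (b := fun s j => eps^-1 * beta s j) i cd ctd (fun j => AC_primitive j Tc Td).
rewrite (duhamel_term _ _ _ _ cd ctd Lb) => wE.
have -> : u t i = 2^-1 + (u t i - 2^-1) by ring.
rewrite wE addrA; congr (_ + _); congr (_ + _).
by rewrite -(flow_kernelE G r eps t (u 0 - cst 2^-1)).
Qed.

End necessity.

(** * The integral formula gives a solution *)

Section sufficiency.
Context (R : realType) (V : finType) (G : wgraph R V) (r eps : R).
Context (T : set R) (hT : is_interval T) (hT0 : T 0).
Context (u beta : R -> V -> R).
Local Notation L := (laplacian G r).
Context (ibeta : locally_integrableV T beta) (bbeta : locally_ae_bounded G r T beta).
Context (uE : forall t, T t ->
        u t = cst 2^-1
              + expR (t / eps) *: heat G r t (u 0 - cst 2^-1)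
              + eps^-1 *: ointegralV 0 t (fun s =>
                  expR ((t - s) / eps) *: heat G r (t - s) (beta s))).

Lemma formula_beta_Linfty a b i : T a -> T b -> Linfty `[a, b] (fun s => beta s i).
Proof.
move=> Ta Tb.
have sub : `[a, b]%classic `<=` T by move=> t; rewrite /= in_itv/= => abt; exact: hT abt.
have bab : bounded_set `[a, b]%classic.
  exact/compact_bounded/segment_compact.
split.
  apply/measurable_EFinP; exact: (measurable_int _ (ibeta sub bab (measurable_itvL _) i)).
have [M hM] := bbeta sub bab.
exists (M / Num.sqrt (degree G i `^ r)); apply: (ae_imply hM) => t h /h hb.
apply: (le_trans (normV_ge G r (beta t) i)).
by rewrite ler_wpM2r// invr_ge0 sqrtr_ge0.
Qed.

(** The time derivative is read off from the differential equation. *)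
Definition formula_du (s : R) (i : V) : R :=
  eps^-1 * (u s i - 2^-1) - L (u s) i + eps^-1 * beta s i.

(** Variation of constants starts at time [0], so it is applied on an interval
    containing [0], [a] and [b] and then restricted to [[a, b]]. *)
Lemma formula_primitive a b i : T a -> T b -> a <= b ->
  primitive a b (fun s => u s i) (fun s => formula_du s i).
Proof.
move=> Ta Tb ab.
have [c [d [Tc Td [cd ca bd]]]] : exists c d, [/\ T c, T d & [/\ c <= 0 <= d, c <= a & b <= d]].
  exists (Num.min a 0), (Num.max b 0); split.
  - by case: leP.
  - by case: leP.
  - by split; rewrite ?ge_min ?le_max lexx ?orbT.
have Lb j := formula_beta_Linfty j Tc Td.
have := duhamel_conv (flow_kernel_matrix_exp G r eps) (w0 := fun j => u 0 j - 2^-1)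
  (w := fun s j => u s j - 2^-1) (b := fun s j => eps^-1 * beta s j) cd _ _ i.
move=> /(_ _ _)/(primitive_sub ca bd) P.
have {P} := primitiveD (P _ _) (primitive_cst a b 2^-1).
have h1 j : Linfty `[c, d] (fun s => eps^-1 * beta s j) by exact: LinftyZ.
move=> /(_ h1); have h2 t : c <= t <= d -> forall j, u t j - 2^-1 =
    \sum_l flow_kernel G r eps t j l * (u 0 l - 2^-1) +
    ointegralV 0 t (fun s j => \sum_l flow_kernel G r eps (t - s) j l * (eps^-1 * beta s l)) j.
  move=> ctd j; rewrite (duhamel_term _ _ _ _ cd ctd Lb) -(flow_kernelE G r eps t (u 0 - cst 2^-1)).
  have -> : u t j = (cst 2^-1
              + expR (t / eps) *: heat G r t (u 0 - cst 2^-1)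
              + eps^-1 *: ointegralV 0 t (fun s =>
                  expR ((t - s) / eps) *: heat G r (t - s) (beta s))) j.
    by rewrite -uE//; exact: hT ctd.
  transitivity (2^-1 + expR (t / eps) * heat G r t (u 0 - cst 2^-1) j +
      (eps^-1 *: ointegralV 0 t (fun s =>
         expR ((t - s) / eps) *: heat G r (t - s) (beta s))) j - 2^-1) => //.
  by rewrite [LHS]addrC !addrA addNr add0r.
move=> /(_ h2); apply: eq_primitive => s _; first by rewrite subrK.
by rewrite addr0 flow_mx_shift.
Qed.

Lemma formula_du_Linfty a b i : T a -> T b -> a <= b ->
  Linfty `[a, b] (fun s => formula_du s i).
Proof. by move=> Ta Tb ab; case: (formula_primitive i Ta Tb ab). Qed.

Lemma formula_time_derivative : time_derivative G r T u formula_du.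
Proof.
move=> a b Ta Tb ab; split.
  by apply: Linfty_L2 => i; apply: formula_du_Linfty => //; exact: ltW.
move=> phi tphi; apply/funext => i.
exact: (primitive_weak_derivative ab (formula_primitive i Ta Tb (ltW ab)) tphi).
Qed.

Lemma formula_H1loc : H1loc G r T u.
Proof.
move=> a b Ta Tb ab; split.
  apply: Linfty_L2 => i.
  exact: primitive_Linfty (formula_primitive i Ta Tb (ltW ab)).
by exists formula_du; exact: formula_time_derivative.
Qed.

Lemma formula_continuous : Defs.continuousV G r T u.
Proof.
apply: lipschitz_continuousV => // a b Ta Tb ab i.
exact: primitive_lip (formula_primitive i Ta Tb ab).
Qed.

End sufficiency.

(** * The equivalence *)

Theorem theorem3p4 (R : realType) (V : finType) (G : wgraph R V)
    (r eps : R) (hr : 0 <= r <= 1) (heps : 0 < eps)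
    (T : set R) (hT : is_interval T) (hT0 : T 0)
    (u beta : R -> V -> R) (hu : forall t, T t -> V01 (u t)) :
  AC_solution G r eps T u beta <->
  [/\ locally_integrableV T beta /\ locally_ae_bounded G r T beta,
      {ae @completed_lebesgue_measure R, forall t, T t ->
        Bset (u t) (beta t)} &
      forall t, T t ->
        u t = cst 2^-1
              + expR (t / eps) *: heat G r t (u 0 - cst 2^-1)
              + eps^-1 *: ointegralV 0 t (fun s =>
                  expR ((t - s) / eps) *: heat G r (t - s) (beta s))].
Proof.
split=> [[_ _ cu [du tdu eqB]]|[[ibeta bbeta] Bbeta uE]].
- split; last by move=> t; exact: (AC_formula heps hT hT0 hu cu tdu eqB).
    split=> A AT bA.
      move=> mA i; apply: (Linfty_integrable_fin mA).
        have [M [_ hM]] := bA.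
        apply: (@mu_bounded_lty _ (- (M + 1)) (M + 1)) => // t At.
        by rewrite /= in_itv/= -ler_norml; apply: hM At; rewrite ltrDl.
      exact: (AC_beta_Linfty heps hT hu cu tdu eqB).
    have [B B0 hB] := AC_beta_bound heps hT hu cu tdu eqB.
    exists (B * Num.sqrt (\sum_i degree G i `^ r)).
    by apply: (ae_imply hB) => t h /AT/h; exact: normV_le.
  by apply: (ae_imply eqB) => t h /h[].
- split.
  + exact: hu.
  + exact: (formula_H1loc hT hT0 ibeta bbeta uE).
  + exact: (formula_continuous hT hT0 ibeta bbeta uE).
  + exists (formula_du G r eps u beta).
      exact: (formula_time_derivative hT hT0 ibeta bbeta uE).
    apply: (ae_imply Bbeta) => t h Tt; split; last exact: h.
    apply/funext => i; rewrite !fctE /= /formula_du /cst.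
    transitivity (eps * (eps^-1 * (u t i - 2^-1) - laplacian G r (u t) i + eps^-1 * beta t i)
      + eps * laplacian G r (u t) i + 2^-1 - u t i) => //.
    by field; rewrite gt_eqF.
Qed.
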